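(* (Generalized Stokes' Theorem) Let $r\ge1$ and $0\le k\le n-1$. Then $$\int_{\partial J}\omega=\int_J d\omega$$ for all $J\in\hat{\mathcal B}_{k+1}^{r-1}$ and $\omega\in\mathcal B_k^r$, or $J\in{}'\mathcal B_{k+1}$ and $\omega\in\mathcal B_k$.
   Context: Chains and forms on $\mathbb R^n$. Fix an inner product on $\mathbb R^n$, extended to $k$-vectors by $\langle u_1\wedge\dots\wedge u_k,v_1\wedge\dots\wedge v_k\rangle=\det(\langle u_i,v_j\rangle)$. A simple $k$-vector $\alpha$ has mass $\|\alpha\|=\sqrt{\langle\alpha,\alpha\rangle}$; a general one has mass $\|\alpha\|=\inf\{\sum\|\alpha_j\|:\alpha=\sum\alpha_j,\ \alpha_j\text{ simple}\}$. $\mathcal A_k$ is the space of Dirac $k$-chains: finite formal sums $\sum(p_i;\alpha_i)$, $p_i\in\mathbb R^n$, $\alpha_i\in\Lambda_k(\mathbb R^n)$ (finitely supported functions $\mathbb R^n\to\Lambda_k(\mathbb R^n)$). With $T_u(p;\alpha)=(p+u;\alpha)$ and $\sigma=u_1\circ\dots\circ u_j$ a symmetric product of vectors, put $\|\sigma\|=\|u_1\|\cdots\|u_j\|$ and $\Delta_\sigma(p;\alpha)=(T_{u_1}-I)\cdots(T_{u_j}-I)(p;\alpha)$ (for $j=0$: $\Delta_\sigma(p;\alpha)=(p;\alpha)$, $\|\sigma\|=1$); this has order $j$. For integers $r\ge0$, $\|A\|_{B^r}=\inf\{\sum_i\|\sigma_i\|\|\alpha_i\|:A=\sum_i\Delta_{\sigma_i}(p_i;\alpha_i)$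 (finite sum), orders $\le r\}$ is a norm on $\mathcal A_k$, and $\hat{\mathcal B}_k^r$ is the completion. The identity maps induce linking maps $\hat{\mathcal B}_k^r\to\hat{\mathcal B}_k^s$ ($r\le s$), and ${}'\mathcal B_k=\varinjlim_r\hat{\mathcal B}_k^r$ with the locally convex inductive limit topology. A $k$-form is a linear functional $\omega$ on $\mathcal A_k$; $\|\omega\|_{B^r}=\max_{0\le j\le r}\sup\{|\omega(\Delta_\sigma(p;\alpha))|:\sigma\text{ of order }j,\ \|\sigma\|\|\alpha\|=1\}$; $\mathcal B_k^r$ is the space of (bounded, measurable) $k$-forms with finite $B^r$ norm; $\mathcal B_k=\bigcap_r\mathcal B_k^r$ is the Fréchet space of smooth $k$-forms with bounds on the derivatives of each order, with the seminorms $\|\cdot\|_{B^r}$. For $J\in\hat{\mathcal B}_k^r$, $\omega\in\mathcal B_k^r$: $\int_J\omega=\lim\omega(A_i)$ for Dirac chains $A_i\to J$ in the $B^r$ norm; for $J\in{}'\mathcal B_k$, $\omega\in\mathcal B_k$, $\int_J\omega$ is computed on any representative of $J$ in some $\hat{\mathcal B}_k^r$. Operators, for $v\in\mathbb R^n$: $E_v^\dagger(p;v_1\wedge\dots\wedge v_k)=\sum_{i=1}^k(-1)^{i+1}\langle v,v_i\rangle(p;v_1\wedge\cdots\widehat{v_i}\cdots\wedge v_k)$ and $P_v(p;\alpha)=\lim_{t\to0}\big[(p+tv;\alpha/t)-(p;\alpha/t)\big]$, extended linearly to Dirac chains and by continuity to $E_v^\dagger:\hat{\mathcal B}_k^r\to\hat{\mathcal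 B}_{k-1}^r$ and $P_v:\hat{\mathcal B}_k^r\to\hat{\mathcal B}_k^{r+1}$, and to the inductive limits. The boundary operator is the continuous operator $\partial=\sum_{i=1}^nP_{e_i}E_{e_i}^\dagger:\hat{\mathcal B}_k^r\to\hat{\mathcal B}_{k-1}^{r+1}$, with $\{e_i\}$ an orthonormal basis of $\mathbb R^n$, and likewise $\partial:{}'\mathcal B_k\to{}'\mathcal B_{k-1}$. $d$ is the exterior derivative.
   Formalization: For r = 1 in the first alternative it is assumed that the limits defining P_v(p;α) exist in the B^1 completion; they never do (Lipschitz forms need not be differentiable), so ∂J is undefined there and the first alternative is in effect proved for r ≥ 2. *)

(* Defs.v *)
Set Warnings "-notation-overridden,-notation-incompatible-prefix".
Set Warnings "-ambiguous-paths,-redundant-canonical-projection".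
From HB Require Import structures.
From mathcomp Require Import all_boot all_order all_algebra all_fingroup.
From mathcomp Require Import finmap generic_quotient ring_quotient.
From mathcomp Require Import all_classical all_reals all_analysis.
From Stdlib Require Import Relation_Operators.

Set Implicit Arguments.
Unset Strict Implicit.
Unset Printing Implicit Defensive.
Import Order.TTheory GRing.Theory Num.Theory.
Import numFieldNormedType.Exports.

Local Open Scope classical_set_scope.
Local Open Scope quotient_scope.
Local Open Scope ring_scope.

(* The completion of a seminormed space: Cauchy sequences modulo sequences
   whose seminorm tends to 0. When the seminorm is a norm this is the usual
   completion. *)
Record seminorm (R : realType) (V : lmodType R) := Seminorm {
  seminorm_fun :> V -> R;
  seminormD : forall x y, seminorm_fun (x + y) <= seminorm_fun x + seminorm_fun y;
  seminormZ : forall a x, seminorm_fun (a *: x) = `|a| * seminorm_fun x }.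

Section SeminormTheory.
Context {R : realType} {V : lmodType R} (N : seminorm V).

Lemma seminorm0 : N 0 = 0.
Proof. by rewrite -[X in N X](scale0r 0) seminormZ normr0 mul0r. Qed.

Lemma seminormN x : N (- x) = N x.
Proof. by rewrite -scaleN1r seminormZ normrN1 mul1r. Qed.

Lemma seminorm_ge0 x : 0 <= N x.
Proof.
have := seminormD N x (- x).
by rewrite subrr seminorm0 seminormN -mulr2n pmulrn_lge0.
Qed.

Lemma seminorm_distC x y : N (x - y) = N (y - x).
Proof. by rewrite -seminormN opprB. Qed.

Lemma seminorm_distD y x z : N (x - z) <= N (x - y) + N (y - z).
Proof. by rewrite -[x - z](subrKA y); exact: seminormD. Qed.

Lemma seminorm_dist x y : `|N x - N y| <= N (x - y).
Proof.
have := seminormD N (y - x) x; have := seminormD N (x - y) y.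
rewrite !subrK seminorm_distC => h1 h2.
by rewrite ler_norml lerBlDr h1 andbT lerNl opprB lerBlDr.
Qed.

Definition sn_cauchy (u : nat -> V) : bool :=
  `[< forall eps : R, 0 < eps ->
      exists m, forall i j, (m <= i)%N -> (m <= j)%N -> N (u i - u j) < eps >].

Lemma sn_cauchyP u : sn_cauchy u <-> (forall eps : R, 0 < eps ->
      exists m, forall i j, (m <= i)%N -> (m <= j)%N -> N (u i - u j) < eps).
Proof. by split=> /asboolP. Qed.

Lemma sn_cauchy_submod : subsemimod_closed sn_cauchy.
Proof.
split; first split.
- apply/sn_cauchyP => e e0; exists 0%N => i j _ _.
  by rewrite subrr seminorm0.
- move=> u v /sn_cauchyP cu /sn_cauchyP cv; apply/sn_cauchyP => e e0.
  have e2 : 0 < e / 2 by rewrite divr_gt0.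
  have [m um] := cu _ e2.
  have [p vp] := cv _ e2.
  exists (maxn m p) => i j; rewrite !geq_max => /andP[mi pi] /andP[mj pj].
  rewrite [X in N X](_ : _ = (u i - u j) + (v i - v j)).
    rewrite [e]splitr (le_lt_trans (seminormD _ _ _))// ltrD ?um ?vp//.
  by rewrite opprD addrACA.
- move=> a u /sn_cauchyP cu; apply/sn_cauchyP => e e0.
  have a1 : 0 < `|a| + 1 by rewrite ltr_wpDl.
  have [m um] := cu (e / (`|a| + 1)) (divr_gt0 e0 a1).
  exists m => i j mi mj.
  rewrite [X in N X](_ : _ = a *: (u i - u j)); last by rewrite scalerBr.
  have := um i j mi mj; rewrite seminormZ ltr_pdivlMr// => /(le_lt_trans _); apply.
  by rewrite mulrC ler_wpM2l ?seminorm_ge0 // lerDl.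
Qed.

HB.instance Definition _ :=
  GRing.isSubmodClosed.Build R (nat -> V) sn_cauchy sn_cauchy_submod.

Record cauchy_seq := CauchySeq
  { cseq_fun :> nat -> V; cseqP : cseq_fun \in sn_cauchy }.

HB.instance Definition _ := [isSub for cseq_fun].
HB.instance Definition _ := [Choice of cauchy_seq by <:].
HB.instance Definition _ := [SubChoice_isSubLmodule of cauchy_seq by <:].

Lemma cseqB (u v : cauchy_seq) i : (u - v) i = u i - v i. Proof. by []. Qed.

Definition sn_null (u : cauchy_seq) : bool := `[< N \o u @ \oo --> (0 : R) >].

Lemma sn_nullP (u : cauchy_seq) : sn_null u <-> N \o u @ \oo --> (0 : R).
Proof. by split=> /asboolP. Qed.

Lemma sn_null_submod : subsemimod_closed sn_null.
Proof.
split; first split.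
- apply/sn_nullP; rewrite (_ : _ \o _ = cst 0); first exact: cvg_cst.
  by apply/funext => i /=; rewrite seminorm0.
- move=> u v /sn_nullP u0 /sn_nullP v0; apply/sn_nullP.
  apply: (@squeeze_cvgr _ _ _ _ (cst 0) (fun i => N (u i) + N (v i))).
  + by apply: nearW => i /=; rewrite seminorm_ge0 seminormD.
  + exact: cvg_cst.
  + by rewrite -[0 in X in _ --> X](addr0 0); exact: cvgD.
- move=> a u /sn_nullP u0; apply/sn_nullP.
  rewrite (_ : _ \o _ = (fun i => `|a| * N (u i))).
    by rewrite -(mulr0 `|a|); apply: cvgM => //; exact: cvg_cst.
  by apply/funext => i /=; rewrite seminormZ.
Qed.

HB.instance Definition _ :=
  GRing.isSubmodClosed.Build R cauchy_seq sn_null sn_null_submod.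

Definition completion : Type := @Quotient.quot cauchy_seq (GRing.ZmodClosed.clone _ sn_null _).
HB.instance Definition _ := GRing.Zmodule.on completion.
HB.instance Definition _ := EqQuotient.on completion.

Definition cpi : cauchy_seq -> completion := \pi_completion.
Definition crep : completion -> cauchy_seq := repr.

Lemma crepK : cancel crep cpi. Proof. exact: reprK. Qed.

Lemma eq_cpi u v : (cpi u = cpi v) <-> sn_null (u - v).
Proof.
split=> [/eqP|] ; first by rewrite -[_ == _]Quotient.idealrBE.
by rewrite -[sn_null _]/(_ \in sn_null) Quotient.idealrBE => /eqP.
Qed.

Lemma cpiD u v : cpi (u + v) = cpi u + cpi v.
Proof. exact: (@Quotient.pi_add cauchy_seq (GRing.ZmodClosed.clone _ sn_null _)). Qed.

Definition cscale (a : R) (x : completion) : completion := cpi (a *: crep x).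

Lemma cpiZ a u : cscale a (cpi u) = cpi (a *: u).
Proof.
apply/eq_cpi; rewrite -scalerBr; apply: (sn_null_submod.2 a).
by apply/eq_cpi; rewrite crepK.
Qed.

Lemma cscaleA a b x : cscale a (cscale b x) = cscale (a * b) x.
Proof. by rewrite -[x]crepK !cpiZ scalerA. Qed.
Lemma cscale1 : left_id 1 cscale.
Proof. by move=> x; rewrite -[x]crepK !cpiZ scale1r. Qed.
Lemma cscaleDr : right_distributive cscale +%R.
Proof.
by move=> a x y; rewrite -[x]crepK -[y]crepK -cpiD !cpiZ -cpiD scalerDr.
Qed.
Lemma cscaleDl x : {morph cscale^~ x : a b / a + b}.
Proof. by move=> a b; rewrite -[x]crepK !cpiZ -cpiD scalerDl. Qed.

HB.instance Definition _ := GRing.Zmodule_isLmodule.Build R completion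
  cscaleA cscale1 cscaleDr cscaleDl.

Lemma scale_cpi a u : a *: cpi u = cpi (a *: u).
Proof. exact: cpiZ. Qed.

Lemma cseq_norm_cvg (u : cauchy_seq) : cvgn (N \o u).
Proof.
apply/cauchy_cvgP/cauchyP => e e0.
have /sn_cauchyP/(_ _ e0)[m um] := cseqP u.
exists (N (u m)), m => //= i /= mi.
by rewrite /ball/= (le_lt_trans (seminorm_dist _ _))// um.
Qed.

Definition cnorm (x : completion) : R := limn (N \o crep x).

Lemma cnorm_pi u : cnorm (cpi u) = limn (N \o u).
Proof.
have /eq_cpi/sn_nullP n0 : cpi (crep (cpi u)) = cpi u by rewrite crepK.
apply/cvg_lim => //; rewrite -(addr0 (limn _)).
rewrite (_ : _ \o _ = fun i => N (u i) + (N (crep (cpi u) i) - N (u i))); last first.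
  by apply/funext => i /=; rewrite addrC subrK.
apply: cvgD; first exact: cseq_norm_cvg.
apply/norm_cvg0P; apply: (squeeze_cvgr _ (cvg_cst 0) n0).
by apply: nearW => i /=; rewrite normr_ge0 seminorm_dist.
Qed.


Lemma cnormD x y : cnorm (x + y) <= cnorm x + cnorm y.
Proof.
rewrite -[x]crepK -[y]crepK -cpiD !cnorm_pi -limD; [|exact: cseq_norm_cvg..].
apply: ler_lim; [exact: cseq_norm_cvg| |].
  by apply: is_cvgD; exact: cseq_norm_cvg.
by apply: nearW => i; exact: seminormD.
Qed.

Lemma cnormZ a x : cnorm (a *: x) = `|a| * cnorm x.
Proof.
rewrite -[x]crepK scale_cpi !cnorm_pi; apply/cvg_lim => //.
rewrite (_ : _ \o _ = fun i => `|a| * N (crep x i)).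
  by apply: cvgM; [exact: cvg_cst|exact: cseq_norm_cvg].
by apply/funext => i /=; exact: seminormZ.
Qed.

Lemma cpi0 : cpi 0 = 0.
Proof. by apply: (addrI (cpi 0)); rewrite -cpiD !addr0. Qed.

Lemma cnorm0_eq0 x : cnorm x = 0 -> x = 0.
Proof.
rewrite -[x]crepK cnorm_pi -cpi0 => x0; apply/eq_cpi/sn_nullP.
by rewrite subr0 -x0; exact: cseq_norm_cvg.
Qed.

HB.instance Definition _ := Lmodule_isNormed.Build R completion
  cnormD cnormZ cnorm0_eq0.

Lemma const_cauchy (v : V) : (fun _ : nat => v) \in sn_cauchy.
Proof.
by apply/sn_cauchyP => e e0; exists 0%N => i j _ _; rewrite subrr seminorm0.
Qed.

Definition cincl (v : V) : completion := cpi (CauchySeq (const_cauchy v)).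

Lemma cincl_is_linear : linear cincl.
Proof.
by move=> a u v; rewrite /cincl scale_cpi -cpiD; congr cpi; exact/val_inj.
Qed.

HB.instance Definition _ :=
  GRing.isLinear.Build R V completion *:%R cincl cincl_is_linear.

Lemma norm_cincl v : `|cincl v| = N v.
Proof.
rewrite [LHS]cnorm_pi; apply: cvg_lim => //.
by rewrite (_ : _ \o _ = cst (N v)) //; exact: cvg_cst.
Qed.

Lemma cpiN u : cpi (- u) = - cpi u.
Proof. by apply: (addrI (cpi u)); rewrite -cpiD !subrr cpi0. Qed.

Lemma cincl_cvg (u : cauchy_seq) : cincl (u i) @[i --> \oo] --> cpi u.
Proof.
apply/cvgrPdist_le => e e0; have /sn_cauchyP/(_ _ e0)[m um] := cseqP u.
exists m => // i /= mi.
rewrite -cpiN -cpiD [leLHS]cnorm_pi; apply: limr_le.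
  exact: cseq_norm_cvg.
by exists m => // j /= mj; exact/ltW/um.
Qed.

Lemma cincl_dense : dense (range cincl).
Proof.
move=> O [x Ox] oO.
have h := @cincl_cvg (crep x); rewrite crepK in h.
have [|m _ mO] := h O; first exact: open_nbhs_nbhs.
by exists (cincl (crep x m)); split; [exact: (mO m (leqnn m))|exists (crep x m)].
Qed.

Lemma completion_complete (F : set_system completion) :
  ProperFilter F -> cauchy F -> cvg F.
Proof.
move=> FF /cauchyP Fc.
have /choice[A FA] : forall n, exists v, F (ball (cincl v) (n.+1%:R^-1 : R)).
  move=> n.
  have e0 : (0 : R) < n.+1%:R^-1 / 2 by rewrite divr_gt0 ?invr_gt0.
  have [x Fx] := Fc _ e0.
  have h := @cincl_cvg (crep x); rewrite crepK in h.
  have [|m _ mO] := h (ball x (n.+1%:R^-1 / 2)); first exact: nbhsx_ballx.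
  exists (crep x m); apply: filterS Fx => y; apply: ball_split.
  by apply: ball_sym; exact: (mO m (leqnn m)).
have small (e : R) : 0 < e -> exists m, forall i, (m <= i)%N -> i.+1%:R^-1 < e.
  move=> e0; have /cvgrPdist_lt/(_ _ e0)[m _ me] := @cvg_harmonic R.
  exists m => i mi; have := me i mi.
  by rewrite sub0r normrN ger0_norm// invr_ge0.
have cA : A \in sn_cauchy.
  apply/sn_cauchyP => e e0; have e2 : 0 < e / 2 by rewrite divr_gt0.
  have [m mP] := small _ e2; exists m => i j mi mj.
  have [y [yi yj]] := filter_ex (filterI (FA i) (FA j)).
  rewrite -norm_cincl linearB/=.
  rewrite (splitr e) (le_lt_trans (ler_distD y _ _))// ltrD//.
    by apply: lt_trans (mP _ mi); move: yi; rewrite -ball_normE.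
  by apply: lt_trans (mP _ mj); move: yj; rewrite -ball_normE/= distrC.
apply/cvg_ex; exists (cpi (CauchySeq cA)).
apply/cvg_ballP => e e0; have e2 : 0 < e / 2 by rewrite divr_gt0.
have [m mP] := small _ e2.
have /cvg_ballP/(_ _ e2)[p _ pP] := @cincl_cvg (CauchySeq cA).
pose i := maxn m p.
apply: filterS (FA i) => y yi.
apply: (ball_split (pP i _)); first by rewrite /= leq_maxr.
by apply: le_ball yi; apply/ltW/mP; rewrite leq_maxl.
Qed.

HB.instance Definition _ := Uniform_isComplete.Build completion
  completion_complete.


End SeminormTheory.

Section ContinuousExtension.
Context {R : realType} {V : lmodType R} (N : seminorm V).

Definition cincl_nbhs (J : completion N) : set_system V :=
  filter_from (nbhs J) (fun U => cincl N @^-1` U).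

(* Extension by continuity: the limit of f A as the image of A in the
   completion tends to J. It is meaningful when that limit exists. *)
Definition cext (Y : ptopologicalType) (f : V -> Y) (J : completion N) : Y :=
  lim (f A @[A --> cincl_nbhs J]).

End ContinuousExtension.

Section DecompositionNorm.
Context {R : realType} {V : lmodType R} {I : Type} (g : I -> V) (w : I -> R).

(* The infimum of \sum_i w i over the finite decompositions v = \sum_i g i;
   both the mass of k-vectors and the B^r norms have this form. *)
Definition decomp_costs (v : V) : set R :=
  [set m | exists s : seq I,
     v = \sum_(i <- s) g i /\ m = \sum_(i <- s) w i].

Definition decomp_norm (v : V) : R := inf (decomp_costs v).

Hypothesis w_ge0 : forall i, 0 <= w i.
Hypothesis gen : forall v, decomp_costs v !=set0.
Hypothesis scal : forall a i, exists j, g j = a *: g i /\ w j = `|a| * w i.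

Lemma decomp_costs_ge0 v m : decomp_costs v m -> 0 <= m.
Proof. by case=> s [_ ->]; apply: sumr_ge0. Qed.

Lemma decomp_costs_has_inf v : has_inf (decomp_costs v).
Proof. by split=> //; exists 0 => m /decomp_costs_ge0. Qed.

Lemma decomp_norm_ge0 v : 0 <= decomp_norm v.
Proof. by apply: lb_le_inf => // m /decomp_costs_ge0. Qed.

Lemma decomp_norm_le v m : decomp_costs v m -> decomp_norm v <= m.
Proof. by move=> h; apply: ge_inf => //; case: (decomp_costs_has_inf v). Qed.

Lemma decomp_normD x y : decomp_norm (x + y) <= decomp_norm x + decomp_norm y.
Proof.
rewrite -lerBlDr; apply: lb_le_inf => // a [s [xs ->]].
rewrite lerBlDr -lerBlDl; apply: lb_le_inf => // b [t [yt ->]].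
rewrite lerBlDl; apply: decomp_norm_le; exists (s ++ t).
by rewrite !big_cat/= -xs -yt.
Qed.

Lemma decomp_normZ_le a x : decomp_norm (a *: x) <= `|a| * decomp_norm x.
Proof.
have cost m : decomp_costs x m -> decomp_costs (a *: x) (`|a| * m).
  case=> s [-> ->] {x m}; have /choice[h hP] := scal a.
  exists (map h s); rewrite !big_map scaler_sumr mulr_sumr.
  by split; apply: eq_bigr => i _; case: (hP i).
have [->|a0] := eqVneq a 0.
  rewrite normr0 mul0r scale0r; apply: decomp_norm_le.
  by exists [::]; rewrite !big_nil.
rewrite mulrC -ler_pdivrMr ?normr_gt0//; apply: lb_le_inf => // m /cost mP.
by rewrite ler_pdivrMr ?normr_gt0// mulrC; exact: decomp_norm_le.
Qed.

Lemma decomp_normZ a x : decomp_norm (a *: x) = `|a| * decomp_norm x.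
Proof.
apply/eqP; rewrite eq_le decomp_normZ_le/=.
have [->|a0] := eqVneq a 0.
  by rewrite normr0 mul0r decomp_norm_ge0.
rewrite mulrC -ler_pdivlMr ?normr_gt0// mulrC -normfV.
by rewrite -{1}[x](scalerK a0) decomp_normZ_le.
Qed.

End DecompositionNorm.


(* Lambda_k(R^n) in the coordinates of its basis e_S = e_{s_0} /\ ... /\ e_{s_(k-1)}
   where S = {s_0 < ... < s_(k-1)} ranges over the k-subsets of 'I_n. *)
Definition kset (n k : nat) : Type := {S : {set 'I_n} | #|S| == k}.
HB.instance Definition _ n k := Finite.on (kset n k).

Definition kset_nth (n k : nat) (S : kset n k) (i : 'I_k) : 'I_n :=
  enum_val (cast_ord (esym (eqP (valP S))) i).

Definition kvector (R : realType) (n k : nat) : Type := {ffun kset n k -> R^o}.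
HB.instance Definition _ R n k := GRing.Lmodule.on (kvector R n k).

Section MultiVectors.
Context {R : realType} {n : nat}.
Implicit Type k : nat.

(* u_0 /\ ... /\ u_(k-1), where u_i is row i of u: its coordinates are the
   maximal minors. *)
Definition kwedge k (u : 'M[R]_(k, n)) : kvector R n k :=
  [ffun S : kset n k => \det (colsub (kset_nth S) u)].

Definition std_rows k (S : kset n k) : 'M[R]_(k, n) :=
  rowsub (kset_nth S) 1%:M.

Lemma kset_nth_inj k (S : kset n k) : injective (kset_nth S).
Proof. by move=> i j /enum_val_inj/cast_ord_inj. Qed.

Lemma codom_kset_nth k (S : kset n k) : codom (kset_nth S) =i val S.
Proof.
move=> x; apply/codomP/idP => [[i ->]|xS]; first exact: enum_valP.
exists (cast_ord (eqP (valP S)) (enum_rank_in xS x)).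
by rewrite /kset_nth cast_ordK enum_rankK_in.
Qed.

Lemma kwedge_std_rows k (S T : kset n k) : kwedge (std_rows S) T = (S == T)%:R.
Proof.
rewrite ffunE; have [<-|ST] := eqVneq S T.
  rewrite (_ : colsub _ _ = 1%:M) ?det1//.
  by apply/matrixP => i j; rewrite !mxE (inj_eq (@kset_nth_inj _ S)).
have [i iT] : exists i, kset_nth S i \notin val T.
  apply/existsP; rewrite -[X in is_true X]negbK negb_exists; apply/negP.
  move=> /forallP sub; case/eqP: ST; apply/val_inj/eqP.
  rewrite eqEcard (eqP (valP S)) (eqP (valP T)) leqnn andbT.
  apply/fintype.subsetP => x; rewrite -codom_kset_nth => /codomP[i ->].
  by have := sub i; rewrite negbK.
rewrite (expand_det_row _ i) big1// => j _; rewrite !mxE.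
case: eqP => [e|_]; last by rewrite mul0r.
by move: iT; rewrite e -codom_kset_nth codom_f.
Qed.

Lemma kvectorE k (a : kvector R n k) :
  a = \sum_(S : kset n k) a S *: kwedge (std_rows S).
Proof.
apply/ffunP => T; rewrite sum_ffunE (bigD1 T)//= big1 => [|S ST].
  by rewrite addr0 ffunE kwedge_std_rows eqxx [_ *: _]mulr1.
by rewrite ffunE kwedge_std_rows (negPf ST) [_ *: _]mulr0.
Qed.

Lemma det_mulmx_expand k (u : 'M[R]_(k, n)) (B : 'M[R]_(n, k)) :
  \det (u *m B) =
  \sum_(f : {ffun 'I_k -> 'I_n}) (\prod_i u i (f i)) * \det (rowsub f B).
Proof.
rewrite /determinant; under [RHS]eq_bigr => f _ do rewrite mulr_sumr.
rewrite exchange_big/=; apply: eq_bigr => s _.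
under eq_bigr do rewrite mxE.
rewrite bigA_distr_bigA/= mulr_sumr; apply: eq_bigr => f _.
rewrite big_split/= mulrCA; do 2!congr (_ * _).
by apply: eq_bigr => i _; rewrite mxE.
Qed.

Lemma kwedgeE k (u : 'M[R]_(k, n)) (T : kset n k) :
  kwedge u T = \det (u *m colsub (kset_nth T) 1%:M).
Proof. by rewrite ffunE mulmx_colsub mulmx1. Qed.

Lemma inj_kset_nth k (f : 'I_k -> 'I_n) : injective f ->
  exists (S : kset n k) (s : {perm 'I_k}), f =1 kset_nth S \o s.
Proof.
move=> fI; have cS : #|f @: [set: 'I_k]%SET| == k.
  by rewrite card_imset// cardsT card_ord.
pose S : kset n k := exist _ (f @: [set: 'I_k]%SET) cS.
have /choice[g gP] : forall i, exists j, f i = kset_nth S j.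
  by move=> i; apply/codomP; rewrite codom_kset_nth imset_f// in_setT.
have gI : injective g by move=> i j gij; apply: fI; rewrite !gP gij.
by exists S, (perm gI) => i /=; rewrite permE.
Qed.

Lemma Cauchy_Binet k (u : 'M[R]_(k, n)) (B : 'M[R]_(n, k)) :
  \det (u *m B) =
  \sum_(S : kset n k)
    \det (colsub (kset_nth S) u) * \det (rowsub (kset_nth S) B).
Proof.
under eq_bigr do rewrite -{1}[u]mulmx1 -mulmx_colsub det_mulmx_expand mulr_suml.
rewrite det_mulmx_expand exchange_big/=; apply: eq_bigr => f _.
under [RHS]eq_bigr do rewrite -mulrA.
rewrite -mulr_sumr; congr (_ * _).
have [/injectiveP fI|/injectivePn[i [j ij fij]]] := boolP (injectiveb f); last first.
  have alt (C : 'M[R]_(n, k)) : \det (rowsub f C) = 0.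
    by apply: (determinant_alternate ij) => l; rewrite !mxE fij.
  by rewrite alt big1// => T _; rewrite alt mul0r.
have [S [s fE]] := inj_kset_nth fI.
have detf (C : 'M[R]_(n, k)) :
    \det (rowsub f C) = (-1) ^+ s * \det (rowsub (kset_nth S) C).
  rewrite -det_perm -det_mulmx -row_permE; congr (\det _).
  by apply/matrixP => i j; rewrite !mxE fE.
have fT (T : kset n k) :
    \det (rowsub f (colsub (kset_nth T) 1%:M)) = (-1 : R) ^+ s * (S == T)%:R.
  rewrite detf -(kwedge_std_rows S T) ffunE; congr (_ * \det _).
  by apply/matrixP => i j; rewrite !mxE.
rewrite (bigD1 S)//= fT eqxx mulr1 big1 ?addr0 => [|T TS]; first exact: detf.
by rewrite fT eq_sym (negPf TS) mulr0 mul0r.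
Qed.

Variable ip : {dot 'rV[R]_n for idfun}.

Definition vnorm (u : 'rV[R]_n) : R := Num.sqrt (ip u u).

Definition gram k (u : 'M[R]_(k, n)) : 'M[R]_k :=
  \matrix_(i, j) ip (row i u) (row j u).

(* The pair (c, u) stands for the simple k-vector c u_0 /\ ... /\ u_(k-1), whose
   mass is |c| sqrt (det <u_i, u_j>). The scalar c matters only for k = 0,
   where the empty wedge is 1. *)
Definition simple_mass k (x : R * 'M[R]_(k, n)) : R :=
  `|x.1| * Num.sqrt (\det (gram x.2)).

Definition simple_kvector k (x : R * 'M[R]_(k, n)) : kvector R n k :=
  x.1 *: kwedge x.2.

Definition mass k (a : kvector R n k) : R :=
  decomp_norm (@simple_kvector k) (@simple_mass k) a.

Lemma simple_mass_ge0 k (x : R * 'M[R]_(k, n)) : 0 <= simple_mass x.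
Proof. by rewrite mulr_ge0 ?sqrtr_ge0. Qed.

Lemma simple_kvector_gen k (a : kvector R n k) :
  decomp_costs (@simple_kvector k) (@simple_mass k) a !=set0.
Proof.
pose s := [seq (a L, std_rows L) | L <- enum {: kset n k}].
exists (\sum_(x <- s) simple_mass x), s; split => //.
by rewrite big_map big_enum/= {1}(kvectorE a).
Qed.

Lemma simple_kvector_scale k (c : R) (x : R * 'M[R]_(k, n)) :
  exists y, simple_kvector y = c *: simple_kvector x /\
            simple_mass y = `|c| * simple_mass x.
Proof.
by exists (c * x.1, x.2); rewrite /simple_kvector /simple_mass/= scalerA normrM mulrA.
Qed.

Lemma mass_ge0 k (a : kvector R n k) : 0 <= mass a.
Proof.
by apply: decomp_norm_ge0; [exact: simple_mass_ge0|exact: simple_kvector_gen].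
Qed.

Lemma massZ k c (a : kvector R n k) : mass (c *: a) = `|c| * mass a.
Proof.
apply: decomp_normZ; [exact: simple_mass_ge0|exact: simple_kvector_gen|].
exact: simple_kvector_scale.
Qed.

(* Linear extension from the basis e_S; contraction_kwedge is the formula on
   an arbitrary simple (k+1)-vector. *)
Definition contraction k (v : 'rV[R]_n) (a : kvector R n k.+1) : kvector R n k :=
  \sum_(S : kset n k.+1) a S *: \sum_(i < k.+1)
    ((-1) ^+ i * ip v (row i (std_rows S))) *: kwedge (row' i (std_rows S)).

Lemma contraction_kwedge k (v : 'rV[R]_n) (u : 'M[R]_(k.+1, n)) :
  contraction v (kwedge u) =
  \sum_(i < k.+1) ((-1) ^+ i * ip v (row i u)) *: kwedge (row' i u).
Proof.
apply/ffunP => T.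
pose B : 'M[R]_(n, k.+1) := \matrix_(a, j)
  if unlift ord0 j is Some l then (a == kset_nth T l)%:R else ip v (delta_mx 0 a).
have detB (w : 'M[R]_(k.+1, n)) :
    (\sum_(i < k.+1) ((-1) ^+ i * ip v (row i w)) *: kwedge (row' i w)) T =
    \det (w *m B).
  rewrite sum_ffunE (expand_det_col _ ord0); apply: eq_bigr => i _.
  rewrite ffunE /cofactor addn0 [LHS]/GRing.scale/= [RHS]mulrCA [RHS]mulrA.
  congr (_ * _ * _).
  - rewrite {1}(row_sum_delta (row i w)) linear_sum/= mxE; apply: eq_bigr => a _.
    by rewrite linearZ/= !mxE unlift_none.
  - rewrite kwedgeE; congr (\det _); apply/matrixP => a j.
    by rewrite !mxE; apply: eq_bigr => b _; rewrite !mxE liftK.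
rewrite detB Cauchy_Binet sum_ffunE; apply: eq_bigr => S _.
by rewrite !ffunE detB /std_rows -rowsubE.
Qed.
End MultiVectors.

Section DiracChains.
Context {R : realType} {n k : nat}.

Definition finsupp (A : 'rV[R]_n -> kvector R n k) : bool :=
  `[< finite_set [set p | A p != 0] >].

Lemma finsupp_submod : subsemimod_closed finsupp.
Proof.
split; first split.
- apply/asboolP; rewrite (_ : [set _ | _] = set0)//.
  by apply/seteqP; split => // p /=; rewrite eqxx.
- move=> A B /asboolP fA /asboolP fB; apply/asboolP.
  apply: (@sub_finite_set _ _ ([set p | A p != 0] `|` [set p | B p != 0])).
    move=> p /=; have [A0|] := eqVneq (A p) 0; last by left.
    have [B0|] := eqVneq (B p) 0; last by right.
    by rewrite /GRing.add/= A0 B0 addr0 eqxx.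
  by rewrite finite_setU.
- move=> a A /asboolP fA; apply/asboolP; apply: sub_finite_set fA => p /=.
  by apply: contra_neq => A0; rewrite /GRing.scale/= A0 scaler0.
Qed.

HB.instance Definition _ :=
  GRing.isSubmodClosed.Build R ('rV[R]_n -> kvector R n k) finsupp finsupp_submod.

End DiracChains.

Record dchain (R : realType) (n k : nat) := DChain
  { dchain_fun :> 'rV[R]_n -> kvector R n k; dchainP : dchain_fun \in finsupp }.

HB.instance Definition _ R n k := [isSub for @dchain_fun R n k].
HB.instance Definition _ R n k := [Choice of dchain R n k by <:].
HB.instance Definition _ R n k := [SubChoice_isSubLmodule of dchain R n k by <:].

Section DiracChainTheory.
Context {R : realType} {n : nat}.
Implicit Type k : nat.

Lemma dirac_finsupp k (p : 'rV[R]_n) (a : kvector R n k) :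
  (fun q => if q == p then a else 0) \in finsupp.
Proof.
apply/asboolP; apply: (@sub_finite_set _ _ [set p]) => //.
by move=> q /=; have [//|_] := eqVneq q p; rewrite eqxx.
Qed.

Definition dirac_chain k (p : 'rV[R]_n) (a : kvector R n k) : dchain R n k :=
  DChain (dirac_finsupp p a).

(* The extension of (p; a) |-> f p a to Dirac chains; the support of A is
   finite. *)
Definition dirac_ext k (Y : lmodType R) (f : 'rV[R]_n -> kvector R n k -> Y)
    (A : dchain R n k) : Y :=
  \sum_(p \in [set: 'rV[R]_n]) f p (A p).

Lemma dirac_extE k (Y : lmodType R) (f : 'rV[R]_n -> kvector R n k -> Y)
    (A : dchain R n k) (D : set 'rV[R]_n) :
  (forall p, f p 0 = 0) -> finite_set D -> [set p | A p != 0] `<=` D ->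
  dirac_ext f A = \sum_(p <- fset_set D) f p (A p).
Proof.
move=> f0 finD AD; rewrite /dirac_ext -fsbig_finite//; apply/esym/fsbig_widen => //.
move=> p /= [_ Dp]; have [->|Ap] := eqVneq (A p) 0; first exact: f0.
by case: Dp; exact: AD.
Qed.

Lemma dirac_ext_linear k (Y : lmodType R) (f : 'rV[R]_n -> kvector R n k -> Y) :
  (forall p, linear (f p)) -> linear (dirac_ext f).
Proof.
move=> lf c A B.
have f0 p : f p 0 = 0.
  by have := lf p (-1) 0 0; rewrite scaler0 add0r scaleN1r addNr.
pose D := [set p | A p != 0] `|` [set p | B p != 0].
have finD : finite_set D.
  by rewrite finite_setU; split; [have := dchainP A|have := dchainP B] => /asboolP.
rewrite !(@dirac_extE _ _ f _ D)//.
- rewrite scaler_sumr -big_split/=; apply: eq_bigr => p _; exact: lf.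
- by move=> p; right.
- by move=> p; left.
- move=> p; have [A0|] := eqVneq (A p) 0; last by left.
  have [B0|] := eqVneq (B p) 0; last by right.
  have -> : [set p | (c *: A + B) p != 0] p = (c *: A p + B p != 0) by [].
  by rewrite A0 B0 scaler0 addr0 eqxx.
Qed.

Lemma dirac_ext_dirac k (Y : lmodType R) (f : 'rV[R]_n -> kvector R n k -> Y) p a :
  (forall p, f p 0 = 0) -> dirac_ext f (dirac_chain p a) = f p a.
Proof.
move=> f0; rewrite (@dirac_extE _ _ f _ [set p])//.
  by rewrite fset_set1 big_seq_fset1/= eqxx.
by move=> q /=; have [//|_] := eqVneq q p; rewrite eqxx.
Qed.

Lemma dirac0 k p : dirac_chain p (0 : kvector R n k) = 0.
Proof.
by apply/val_inj/funext => q /=; case: ifP.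
Qed.

Lemma dchain_sum k (J : Type) (s : seq J) (F : J -> dchain R n k) q :
  (\sum_(j <- s) F j) q = \sum_(j <- s) F j q.
Proof.
by elim/big_rec2 : _ => // j x y _ <-.
Qed.

Lemma dchainE k (A : dchain R n k) : A = dirac_ext (@dirac_chain k) A.
Proof.
have fA : finite_set [set p | A p != 0] by have /asboolP := dchainP A.
rewrite (@dirac_extE _ _ _ A _ (@dirac0 k) fA)//.
apply/val_inj/funext => q; rewrite /= dchain_sum.
have [Aq|Aq] := eqVneq (A q) 0.
  by rewrite big1 ?Aq// => p _ /=; have [<-|//] := eqVneq q p.
rewrite (bigD1_seq q)/= ?fset_uniq//; last by rewrite in_fset_set// inE.
rewrite eqxx big1 ?addr0// => p pq.
by rewrite eq_sym (negPf pq).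
Qed.

Definition translate k (u : 'rV[R]_n) : dchain R n k -> dchain R n k :=
  dirac_ext (fun p a => dirac_chain (p + u) a).

(* Translations commute, so the symmetric product u_1 o ... o u_j is
   represented by any sequence listing its factors. *)
Definition Delta k (s : seq 'rV[R]_n) (A : dchain R n k) : dchain R n k :=
  foldr (fun u B => translate u B - B) A s.

Lemma dirac_linear k p : linear (@dirac_chain k p).
Proof.
move=> c a b; apply/val_inj/funext => q.
rewrite [RHS](_ : _ = c *: dirac_chain p a q + dirac_chain p b q)//=.
by case: ifP => //; rewrite scaler0 addr0.
Qed.

Lemma translate_linear k u : linear (@translate k u).
Proof. by apply: dirac_ext_linear => p; exact: dirac_linear. Qed.

Lemma Delta_scale k s c (A : dchain R n k) : Delta s (c *: A) = c *: Delta s A.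
Proof.
elim: s => //= u s ->.
have T0 : translate u (0 : dchain R n k) = 0.
  have := @translate_linear k u (-1) 0 0.
  by rewrite scaler0 add0r scaleN1r addNr.
have := @translate_linear k u c (Delta s A) 0.
by rewrite addr0 T0 addr0 scalerBr => ->.
Qed.

End DiracChainTheory.

Section BNorm.
Context {R : realType} {n : nat} (ip : {dot 'rV[R]_n for idfun}) (k r : nat).

Let index : Type := (r.-bseq 'rV[R]_n * 'rV[R]_n * kvector R n k)%type.

Definition diff_chain (x : index) : dchain R n k := Delta x.1.1 (dirac_chain x.1.2 x.2).

Definition diff_cost (x : index) : R :=
  (\prod_(u <- x.1.1) vnorm ip u) * mass ip x.2.

Definition Bnorm (A : dchain R n k) : R := decomp_norm diff_chain diff_cost A.

Lemma diff_cost_ge0 x : 0 <= diff_cost x.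
Proof.
by rewrite mulr_ge0 ?mass_ge0// prodr_ge0// => u _; exact: sqrtr_ge0.
Qed.

Lemma diff_chain_gen A : decomp_costs diff_chain diff_cost A !=set0.
Proof.
pose s : seq index := [seq ([bseq], p, A p) |
  p <- fset_set [set p | A p != 0] : seq _].
exists (\sum_(x <- s) diff_cost x), s; split => //.
have fA : finite_set [set p | A p != 0] by have /asboolP := dchainP A.
by rewrite big_map {1}(dchainE A) (@dirac_extE _ _ _ _ _ A _ (@dirac0 _ _ k) fA).
Qed.

Lemma diff_chain_scale c x :
  exists y, diff_chain y = c *: diff_chain x /\ diff_cost y = `|c| * diff_cost x.
Proof.
exists (x.1, c *: x.2); rewrite /diff_chain /diff_cost/= massZ mulrCA; split => //.
rewrite -Delta_scale; congr Delta.
have := dirac_linear x.1.2 c x.2 0.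
by rewrite dirac0 !addr0.
Qed.

Lemma BnormD A B : Bnorm (A + B) <= Bnorm A + Bnorm B.
Proof. exact: decomp_normD diff_cost_ge0 diff_chain_gen A B. Qed.

Lemma BnormZ c A : Bnorm (c *: A) = `|c| * Bnorm A.
Proof.
exact: decomp_normZ diff_cost_ge0 diff_chain_gen diff_chain_scale c A.
Qed.

Definition Bseminorm : seminorm (dchain R n k) := Seminorm BnormD BnormZ.

Definition Bhat : Type := completion Bseminorm.
HB.instance Definition _ := CompleteNormedModule.on Bhat.

Definition Bincl : dchain R n k -> Bhat := cincl Bseminorm.

End BNorm.

Section Operators.
Context {R : realType} {n : nat} (ip : {dot 'rV[R]_n for idfun}).
Implicit Types k r s : nat.

Definition Blink k r s (J : Bhat ip k r) : Bhat ip k s := cext (Bincl ip s) J.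

Definition contract_chain k v (A : dchain R n k.+1) : dchain R n k :=
  dirac_ext (fun p a => dirac_chain p (contraction ip v a)) A.

Definition contract_hat k r v (J : Bhat ip k.+1 r) : Bhat ip k r :=
  cext (fun A => Bincl ip r (contract_chain v A)) J.

Definition diff_quotient k v p (a : kvector R n k) (t : R) : dchain R n k :=
  dirac_chain (p + t *: v) (t^-1 *: a) - dirac_chain p (t^-1 *: a).

Definition prederiv_dirac k r v p (a : kvector R n k) : Bhat ip k r :=
  lim (Bincl ip r (diff_quotient v p a t) @[t --> (0 : R)^']).

(* For r >= 2 the limit exists. For r = 1 it does not when v and a are nonzero:
   paired with a bounded Lipschitz k-form w, the quotient is the difference
   quotient of q |-> w (q; a) at p, which need not converge. So P_v maps
   Bhat k r to Bhat k r.+1 only for r >= 1. *)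
Definition prederiv_exists k r : Prop := forall v p (a : kvector R n k),
  cvg (Bincl ip r (diff_quotient v p a t) @[t --> (0 : R)^']).

Definition prederiv_hat k r v (J : Bhat ip k r) : Bhat ip k r.+1 :=
  cext (dirac_ext (prederiv_dirac r.+1 v)) J.

Definition boundary k r (e : 'I_n -> 'rV[R]_n) (J : Bhat ip k.+1 r) :
    Bhat ip k r.+1 :=
  \sum_(i < n) prederiv_hat (e i) (contract_hat (e i) J).

End Operators.

Section Forms.
Context {R : realType} {n : nat}.
Implicit Types k r : nat.

Definition kform k : Type := {scalar dchain R n k}.

Definition kform_norm (ip : {dot 'rV[R]_n for idfun}) k r (w : kform k) : \bar R :=
  \big[maxe/-oo%E]_(j < r.+1)
    ereal_sup [set x : \bar R | exists (s : j.-tuple 'rV[R]_n) p (a : kvector R n k),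
      (\prod_(u <- s) vnorm ip u) * mass ip a = 1 /\
      x = (`|w (Delta s (dirac_chain p a))|)%:E].

(* Measurability is with respect to the Borel sigma-algebra of R^n. The case
   j = 0 of the norm is the bound on w. *)
Definition B_kform (ip : {dot 'rV[R]_n for idfun}) k r (w : kform k) : Prop :=
  (forall (a : kvector R n k) (U : set R), open U ->
     <<s [set W : set 'rV[R]_n | open W] >> ((fun p => w (dirac_chain p a)) @^-1` U)) /\
  (kform_norm ip r w < +oo)%E.

(* dw = \sum_I dw_I /\ dx_I in the standard coordinates, that is,
   dw (e_S) = \sum_i (-1)^i d/dx_{s_i} w (e_{S minus s_i}). *)
Definition ext_deriv_at k (w : kform k) (p : 'rV[R]_n) (a : kvector R n k.+1) : R^o :=
  \sum_(S : kset n k.+1) a S * \sum_(i < k.+1)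
    (-1) ^+ i * 'D_(row i (std_rows S)) (fun q => w (dirac_chain q (kwedge (row' i (std_rows S)))) : R^o) p.

Definition ext_deriv_fun k (w : kform k) : dchain R n k.+1 -> R :=
  dirac_ext (ext_deriv_at w).

Lemma ext_deriv_linear k (w : kform k) : scalar (ext_deriv_fun w).
Proof.
move=> c A B; apply: (dirac_ext_linear (Y := R^o)) => p {}c a b.
rewrite scaler_sumr -big_split/=; apply: eq_bigr => S _.
by rewrite !ffunE mulrDl -mulrA.
Qed.

HB.instance Definition _ k (w : kform k) :=
  GRing.isLinear.Build R (dchain R n k.+1) R *%R (ext_deriv_fun w)
    (ext_deriv_linear w).

Definition ext_deriv k (w : kform k) : kform k.+1 := ext_deriv_fun w.

Definition integral_chain (ip : {dot 'rV[R]_n for idfun}) k r (J : Bhat ip k r) (w : kform k) : R :=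
  cext (w : dchain R n k -> R) J.

End Forms.

Section InductiveLimit.
Context {R : realType} {n : nat} (ip : {dot 'rV[R]_n for idfun}).

Section Germs.
Variable k : nat.

(* The direct limit of the Bhat k r as a set: the disjoint union modulo the
   equivalence generated by identifying J with its images under the linking
   maps. Its topology plays no role for the maps below, which are given on
   representatives. *)
Definition germ : Type := {r : nat & Bhat ip k r}.
HB.instance Definition _ := Choice.on germ.

Inductive Blink_step : germ -> germ -> Prop :=
  LinkStep r s (J : Bhat ip k r) of (r <= s)%N :
    Blink_step (existT _ r J) (existT _ s (Blink s J)).

Definition germ_equiv (x y : germ) : bool :=
  `[< clos_refl_sym_trans _ Blink_step x y >].

Lemma germ_equivP : equiv_class_of germ_equiv.
Proof.
split=> [x|x y|y x z]; first by apply/asboolP/rst_refl.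
  by apply/idP/idP => /asboolP xy; apply/asboolP; exact: rst_sym.
by move=> /asboolP xy /asboolP yz; apply/asboolP; exact: rst_trans xy yz.
Qed.

Canonical germ_equiv_rel := EquivRelPack germ_equivP.

Definition Bind : Type := {eq_quot germ_equiv}.
HB.instance Definition _ := EqQuotient.on Bind.

End Germs.

(* The representative is moved up one level since P_v requires r >= 1. *)
Definition boundary_ind k (e : 'I_n -> 'rV[R]_n) (J : Bind k.+1) : Bind k :=
  \pi_(Bind k) (existT _ _ (boundary e (Blink (tag (repr J)).+1 (tagged (repr J))))).

Definition integral_ind k (J : Bind k) (w : kform k) : R :=
  integral_chain (tagged (repr J)) w.

End InductiveLimit.

(* Main.v *)
Require Import Defs.
From mathcomp Require Import all_boot all_order all_algebra.
From mathcomp Require Import all_classical all_reals all_analysis.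
From mathcomp Require Import finmap generic_quotient ring lra.
(* Other imports also define contraction and dirac0. *)
Import Defs.

(** Why the theorem holds.  Both sides are values at J of functionals that are
continuous in the norm of B^(r-1) and J is a limit of Dirac chains, so it is
enough to compare them on a Dirac chain A and pass to the limit
(stokes_hat).  On A the boundary is \sum_i P_{e_i} E_{e_i} A, where P_v A is
the limit of the difference quotients (T_{tv} A - A) / t; evaluating a form w
on it gives, since w is continuous, the directional derivatives
D_{e_i} w (p; E_{e_i} a).  The exterior derivative is a sum of derivatives of w
in the standard directions; expanding these directions in the orthonormal
frame e turns one sum into the other (ext_derivE).

Three points carry the analysis.

- All the operators are bounded.  An estimate for a linear map on chains is
  needed only on the generators Delta_s (p; a) of the norm (Bnorm_bound), where
  translations, differences and contractions act by the obvious formulas.  The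
  input about the mass of k-vectors is that it dominates the coordinates
  (coord_le_mass), a consequence of the Cauchy-Binet formula
  det <u_i, u_j> = \sum_S (minor_S)^2 in an orthonormal frame.

- P_v exists in B^r for r >= 2 (prederiv_exists_high).  Put
  D t = T_{tv} (p; a) - (p; a).  Then D (s + t) - D s - D t is a second
  difference, of size O(|s| |t|) in B^2, while D t = O(|t|); and in a complete
  space every such quasi-additive D is differentiable at 0
  (quasi_additive_cvg).

- P_v A is linear in v (prederivD, prederivZ): in
  T_{t(u+v)} - I = T_{tu} (T_{tv} - I) + (T_{tu} - I) the factor T_{tu}
  disappears in the limit, because translations converge strongly to the
  identity (translate_vanish).  The argument applies at every level at which P
  exists, including r = 1 when P is assumed to exist there.

For the inductive limit, the integral of a form bounded in every norm does not
change along the linking maps, hence it depends only on the class of a germ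
(integral_germ).  The exterior derivative is again bounded in every norm; at
level 0, where P would have to exist in B^1, this comes from the existence of the
derivatives at a higher level and the bound on the first differences of w
(ext_deriv_bounded). *)

Set Implicit Arguments.
Unset Strict Implicit.
Unset Printing Implicit Defensive.
Import Order.TTheory GRing.Theory Num.Theory.
Import numFieldNormedType.Exports.

Local Open Scope classical_set_scope.
Local Open Scope quotient_scope.
Local Open Scope ring_scope.

(** * Linear maps, seminorms and decompositions *)

Lemma linear_sub {R : realType} {V W : lmodType R} (f : V -> W) :
  linear f -> {morph f : u v / u - v}.
Proof. by move=> fl u v; rewrite addrC -scaleN1r fl scaleN1r addrC. Qed.

Lemma linear_map0 {R : realType} {V W : lmodType R} (f : V -> W) :
  linear f -> f 0 = 0.
Proof. by move=> fl; rewrite -(subrr 0) (linear_sub fl) subrr. Qed.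

Lemma linear_scale {R : realType} {V W : lmodType R} (f : V -> W) c v :
  linear f -> f (c *: v) = c *: f v.
Proof. by move=> fl; rewrite -[c *: v]addr0 fl linear_map0// addr0. Qed.

Lemma linear_comp {R : realType} {U V W : lmodType R} (f : V -> W) (g : U -> V) :
  linear f -> linear g -> linear (f \o g).
Proof. by move=> fl gl c x y; rewrite /= gl fl. Qed.

Lemma linear_sum_scale {R : realType} {V W : lmodType R} (f : V -> W)
    {I : Type} (s : seq I) (c : I -> R) (x : I -> V) :
  linear f -> f (\sum_(i <- s) c i *: x i) = \sum_(i <- s) c i *: f (x i).
Proof.
move=> f_lin; elim: s => [|i s IH]; last by rewrite !big_cons f_lin IH.
by rewrite !big_nil linear_map0.
Qed.

Lemma seminorm_sum {R : realType} {V : lmodType R} (M : seminorm V)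
    {I : Type} (s : seq I) (F : I -> V) :
  M (\sum_(i <- s) F i) <= \sum_(i <- s) M (F i).
Proof.
elim: s => [|i s IH]; first by rewrite !big_nil seminorm0.
by rewrite !big_cons (le_trans (seminormD _ _ _))// lerD.
Qed.

Definition abs_seminorm {R : realType} : seminorm R^o :=
  Seminorm (@ler_normD R R^o) (@normrZ R R^o).

(** Subadditivity reduces a bound on f v to the terms of a decomposition of v;
the infimum over decompositions then gives the factor C. *)
Lemma decomp_norm_bound {R : realType} {V W : lmodType R} {I : Type}
    (g : I -> V) (w : I -> R) (M : seminorm W) (f : V -> W) (C : R) v :
  decomp_costs g w v !=set0 -> 0 <= C -> linear f ->
  (forall i, M (f (g i)) <= C * w i) -> M (f v) <= C * decomp_norm g w v.
Proof.
move=> gen C0 f_lin bound.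
have sumle s : M (f (\sum_(i <- s) g i)) <= C * \sum_(i <- s) w i.
  elim: s => [|i s IH]; first by rewrite !big_nil linear_map0// seminorm0 mulr0.
  rewrite !big_cons mulrDr -[g i]scale1r f_lin scale1r.
  by rewrite (le_trans (seminormD _ _ _))// lerD.
(* The infimum can be divided by C only when C is positive. *)
have [CE|C_neq0] := eqVneq C 0.
  by case: gen => _ [s [-> _]]; have := sumle s; rewrite CE !mul0r.
have C_gt0 : 0 < C by rewrite lt_def C_neq0.
rewrite mulrC -ler_pdivrMr//; apply: lb_le_inf => // m [s [-> ->]].
by rewrite ler_pdivrMr// mulrC.
Qed.

(** * Extension by continuity to a completion *)

Section LinearExtension.
Context {R : realType} {V : lmodType R} (N : seminorm V).

Lemma cincl_nbhs_filter (J : completion N) : ProperFilter (cincl_nbhs J).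
Proof.
apply: filter_from_proper.
  apply: filter_from_filter; first by exists setT; exact: filterT.
  move=> A B nA nB; exists (A `&` B) => //; exact: filterI.
move=> A; rewrite nbhsE; case=> O [oO OJ] OA.
have [|x [Ox [v _ vx]]] := @cincl_dense _ _ N O _ oO; first by exists J.
by exists v; apply: OA; rewrite vx.
Qed.

Local Existing Instance cincl_nbhs_filter.

Lemma cvg_cincl_nbhs {T : Type} (F : set_system T) {FF : Filter F}
    (u : T -> V) (J : completion N) :
  cincl N (u x) @[x --> F] --> J -> u x @[x --> F] --> cincl_nbhs J.
Proof.
move=> uJ A [U UJ UA]; have FU := uJ U UJ.
by apply: (@filterS _ F FF _ _ _ FU) => x; exact: UA.
Qed.

Lemma crep_cvg (J : completion N) : cincl N (crep J i) @[i --> \oo] --> J.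
Proof. by rewrite -[X in _ --> X]crepK; exact: cincl_cvg. Qed.

Context {W : completeNormedModType R} (f : V -> W) (C : R).
Hypothesis f_lin : linear f.
Hypothesis f_le : forall v, `|f v| <= C * N v.

(** The image filter is Cauchy: two chains near J are near each other in the
seminorm, and f does not expand it by more than the factor C. *)
Lemma cext_cvg (J : completion N) : f A @[A --> cincl_nbhs J] --> cext f J.
Proof.
apply: cauchy_cvg; apply/cauchyP => eps eps0.
pose K := `|C| + 1.
have K0 : 0 < K by rewrite ltr_wpDl.
have d0 : 0 < eps / 2 / K by rewrite !divr_gt0.
have FJ : cincl_nbhs J (cincl N @^-1` ball J (eps / 2 / K)).
  by exists (ball J (eps / 2 / K)) => //; exact: nbhsx_ballx.
have [A JA] := filter_ex FJ.
exists (f A); apply: filterS FJ => B JB.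
rewrite -ball_normE /ball_/= -(linear_sub f_lin) (le_lt_trans (f_le _))//.
have : `|cincl N A - cincl N B| < eps / K.
  rewrite -(subrKA J) (le_lt_trans (ler_normD _ _))//.
  rewrite (_ : eps / K = eps / 2 / K + eps / 2 / K); last by rewrite -mulrDl -splitr.
  move: JA JB; rewrite -!ball_normE /ball_/= => JA JB.
  by rewrite ltrD// distrC.
rewrite -linearB norm_cincl ltr_pdivlMr// mulrC; apply: le_lt_trans.
by rewrite ler_wpM2r ?seminorm_ge0// (le_trans (ler_norm _))// lerDl.
Qed.

Lemma cvg_cext {T : Type} (F : set_system T) {FF : Filter F}
    (u : T -> V) (J : completion N) :
  cincl N (u x) @[x --> F] --> J -> f (u x) @[x --> F] --> cext f J.
Proof. by move=> uJ; exact: (cvg_comp _ _ (cvg_cincl_nbhs uJ) (@cext_cvg J)). Qed.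

(** Linearity and the bound pass to the limit along representatives of J. *)
Lemma cext_linear : linear (cext f : completion N -> W).
Proof.
move=> a J K; pose u i := a *: crep J i + crep K i.
apply: (@cvg_unique _ (@norm_hausdorff _ W) (f \o u @ \oo)).
  apply: (@cvg_cext _ _ _ u); rewrite /u.
  under eq_fun do rewrite linearP.
  by apply: cvgD; [apply: cvgZ; [exact: cvg_cst|]|]; exact: crep_cvg.
rewrite (_ : f \o u = fun i => a *: f (crep J i) + f (crep K i)); last first.
  by apply/funext => i /=; rewrite f_lin.
by apply: cvgD; [apply: cvgZ; [exact: cvg_cst|]|]; apply: cvg_cext; exact: crep_cvg.
Qed.

Lemma cext_le (J : completion N) : `|cext f J| <= C * `|J|.
Proof.
have fJ : `|f (crep J i)| @[i --> \oo] --> `|cext f J|.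
  by apply: cvg_norm; apply: cvg_cext; exact: crep_cvg.
have NJ : C * `|cincl N (crep J i)| @[i --> \oo] --> C * `|J|.
  by apply: cvgM; [exact: cvg_cst|apply: cvg_norm; exact: crep_cvg].
apply: ler_cvg_to fJ NJ _; apply: nearW => i.
by rewrite norm_cincl.
Qed.

End LinearExtension.

Section BoundedLinear.
Context {R : realType} {V W : normedModType R} (f : V -> W) (C : R).
Hypothesis f_lin : linear f.
Hypothesis f_le : forall v, `|f v| <= C * `|v|.

Lemma bounded_cvg {T : Type} (F : set_system T) {FF : Filter F} (u : T -> V) J :
  u x @[x --> F] --> J -> f (u x) @[x --> F] --> f J.
Proof.
move=> uJ; have uJ0 : `|C| * `|u x - J| @[x --> F] --> (0 : R).
  rewrite -(mulr0 `|C|); apply: cvgM; first exact: cvg_cst.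
  by apply/norm_cvg0P; apply/subr_cvg0; exact: uJ.
apply/subr_cvg0/norm_cvg0P; apply: (squeeze_cvgr _ (cvg_cst 0) uJ0).
apply: nearW => x; rewrite normr_ge0/=.
by rewrite -(linear_sub f_lin) (le_trans (f_le _))// ler_wpM2r// ler_norm.
Qed.

End BoundedLinear.

(** * Orthonormal frames and the mass of k-vectors *)

Section DotProduct.
Context {R : realType} {n : nat} (ip : {dot 'rV[R]_n for idfun}).

Lemma dotC u v : ip u v = ip v u.
Proof. by rewrite hermC expr0 mul1r. Qed.

Lemma vnorm_ge0 u : 0 <= vnorm ip u.
Proof. exact: sqrtr_ge0. Qed.

Lemma vnormZ c u : vnorm ip (c *: u) = `|c| * vnorm ip u.
Proof.
rewrite /vnorm linearZl_LR linearZr_LR/= mulrA -expr2 sqrtrM ?sqr_ge0//.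
by rewrite sqrtr_sqr.
Qed.

Lemma vnorm_eq0 u : vnorm ip u = 0 -> u = 0.
Proof.
have [//|/neq0_dnorm_gt0 u0 /eqP] := eqVneq u 0.
by rewrite sqrtr_eq0 leNgt u0.
Qed.

Context (e : 'I_n -> 'rV[R]_n).
Hypothesis e_orthonormal : forall i j, ip (e i) (e j) = (i == j)%:R.

Definition frame : 'M[R]_n := \matrix_i e i.

Definition coords k (u : 'M[R]_(k, n)) : 'M[R]_(k, n) :=
  \matrix_(i, j) ip (row i u) (e j).

Lemma coordsE k (u : 'M[R]_(k, n)) : coords u = u *m coords 1%:M.
Proof.
apply/matrixP => i j; rewrite !mxE (row_sum_delta (row i u)) linear_sumlz.
by apply: eq_bigr => a _; rewrite linearZl_LR !mxE row1.
Qed.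

(** The frame times the matrix of coordinates of the standard basis is the
identity by orthonormality, and a one-sided inverse of a square matrix is
two-sided. *)
Lemma coordsK k (u : 'M[R]_(k, n)) : coords u *m frame = u.
Proof.
rewrite coordsE -mulmxA (mulmx1C (A := frame)) ?mulmx1// -coordsE.
by apply/matrixP => i j; rewrite !mxE rowK e_orthonormal.
Qed.

Lemma row_coords k (u : 'M[R]_(k, n)) i :
  row i u = \sum_j ip (row i u) (e j) *: e j.
Proof.
rewrite -{1}(coordsK u) row_mul mulmx_sum_row; apply: eq_bigr => j _.
by rewrite !mxE rowK.
Qed.

Lemma vec_coords (u : 'rV[R]_n) : u = \sum_j ip u (e j) *: e j.
Proof.
have rowu : row ord0 u = u by apply/rowP => j; rewrite mxE.
by rewrite -{1}rowu row_coords rowu.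
Qed.

Lemma gram_coords k (u : 'M[R]_(k, n)) : gram ip u = coords u *m (coords u)^T.
Proof.
apply/matrixP => i j; rewrite !mxE {1}(row_coords u i) linear_sumlz.
by apply: eq_bigr => l _; rewrite linearZl_LR !mxE; congr (_ * _); exact: dotC.
Qed.

(** The Cauchy-Binet formula for the square of the mass of a simple k-vector. *)
Lemma det_gram k (u : 'M[R]_(k, n)) :
  \det (gram ip u) = \sum_(S : kset n k) kwedge (coords u) S ^+ 2.
Proof.
rewrite gram_coords Cauchy_Binet; apply: eq_bigr => S _.
by rewrite ffunE expr2 -trmx_mxsub det_tr.
Qed.

Lemma kwedge_frame k (u : 'M[R]_(k, n)) (S : kset n k) :
  kwedge u S = \sum_(T : kset n k)
    kwedge (coords u) T * \det (rowsub (kset_nth T) (colsub (kset_nth S) frame)).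
Proof.
rewrite -[in LHS](coordsK u) ffunE -mulmx_colsub Cauchy_Binet.
by apply: eq_bigr => T _; rewrite ffunE.
Qed.

(** For a simple k-vector, a coordinate is a fixed linear combination of the
minors in the frame e (kwedge_frame), each at most sqrt (det gram)
by det_gram. *)
Lemma coord_le_mass k :
  exists2 C, 0 <= C & forall (a : kvector R n k) S, `|a S| <= C * mass ip a.
Proof.
pose D (S T : kset n k) := `|\det (rowsub (kset_nth T) (colsub (kset_nth S) frame))|.
pose C := \sum_S \sum_T D S T.
have C0 : 0 <= C.
  by rewrite sumr_ge0// => S _; rewrite sumr_ge0// => T _; exact: normr_ge0.
exists C => // a S.
apply: (@decomp_norm_bound R (kvector R n k) R^o _ (@simple_kvector R n k)
  (@simple_mass R n ip k) abs_seminorm (fun a => a S)) => //.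
- exact: simple_kvector_gen.
- by move=> c x y; rewrite !ffunE.
move=> [c u]; rewrite /simple_kvector /simple_mass /= ffunE [_ *: _]/(_ * _) normrM.
rewrite mulrCA ler_wpM2l// kwedge_frame (le_trans (ler_norm_sum _ _ _))//.
have CS : \sum_T D S T <= C.
  rewrite /C [leRHS](bigD1 S)//= lerDl sumr_ge0// => S' _.
  by rewrite sumr_ge0// => T _; exact: normr_ge0.
apply: le_trans (ler_wpM2r (sqrtr_ge0 _) CS).
rewrite mulr_suml ler_sum// => T _; rewrite normrM mulrC ler_wpM2l//.
rewrite -sqrtr_sqr ler_wsqrtr// det_gram (bigD1 T)//= lerDl.
by rewrite sumr_ge0// => ? _; exact: sqr_ge0.
Qed.

Lemma mass_eq0 k (a : kvector R n k) : mass ip a = 0 -> a = 0.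
Proof.
have [C _ aC] := coord_le_mass k => a0; apply/ffunP => S; rewrite [RHS]ffunE.
by apply/eqP; rewrite -normr_le0 (le_trans (aC a S))// a0 mulr0.
Qed.

Lemma massD k (a b : kvector R n k) : mass ip (a + b) <= mass ip a + mass ip b.
Proof.
by apply: decomp_normD; [exact: simple_mass_ge0|exact: simple_kvector_gen].
Qed.

Definition mass_seminorm k : seminorm (kvector R n k) :=
  Seminorm (@massD k) (@massZ R n ip k).

(** The mass is dominated by the coordinates by subadditivity, and dominates
them by coord_le_mass. *)
Lemma mass_linear_le k l (f : kvector R n k -> kvector R n l) : linear f ->
  exists2 C, 0 <= C & forall a, mass ip (f a) <= C * mass ip a.
Proof.
move=> f_lin; have [C C0 aC] := coord_le_mass k.
exists (\sum_(S : kset n k) C * mass ip (f (kwedge (std_rows S)))).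
  by rewrite sumr_ge0// => S _; rewrite mulr_ge0// mass_ge0.
move=> a; rewrite {1}(kvectorE a) (linear_sum_scale _ _ _ f_lin).
apply: le_trans (seminorm_sum (mass_seminorm l) _ _) _.
rewrite mulr_suml ler_sum// => S _ /=.
by rewrite massZ mulrAC ler_wpM2r// mass_ge0.
Qed.
End DotProduct.

(** * Dirac chains, differences and the B^r norms *)

Section Chains.
Context {R : realType} {n : nat}.
Implicit Types k r : nat.

Lemma dchain_eval_linear k q : linear (fun A : dchain R n k => A q).
Proof. by []. Qed.

(** The point chains span: every formula below that is linear in the chain is
checked on them. *)
Lemma dchain_linear_ext k (W : lmodType R) (f g : dchain R n k -> W) :
  linear f -> linear g ->
  (forall p a, f (dirac_chain p a) = g (dirac_chain p a)) -> f =1 g.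
Proof.
move=> fl gl fg A.
have fA : finite_set [set p | A p != 0] by have /asboolP := dchainP A.
rewrite (dchainE A) (@dirac_extE _ _ _ _ _ A _ (@dirac0 _ _ k) fA)//.
under eq_bigr do rewrite -[dirac_chain _ _]scale1r.
rewrite (linear_sum_scale _ _ _ fl) (linear_sum_scale _ _ _ gl).
by apply: eq_bigr => p _; rewrite fg.
Qed.

Lemma translate_dirac k u p (a : kvector R n k) :
  translate u (dirac_chain p a) = dirac_chain (p + u) a.
Proof. by rewrite /translate dirac_ext_dirac// => q; exact: dirac0. Qed.

(** The pointwise form turns every identity between translations, sums and
contractions of chains into an identity of k-vectors. *)
Lemma translateE k u (A : dchain R n k) q : translate u A q = A (q - u).
Proof.
move: A; apply: dchain_linear_ext => // [|p a].
  exact: (linear_comp (@dchain_eval_linear k q) (translate_linear u)).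
by rewrite translate_dirac/= subr_eq.
Qed.

End Chains.

Section Contraction.
Context {R : realType} {n : nat} (ip : {dot 'rV[R]_n for idfun}).
Implicit Types k r : nat.

Lemma contraction_linear k v : linear (@contraction R n ip k v).
Proof.
move=> c a b; rewrite /contraction scaler_sumr -big_split/=.
by apply: eq_bigr => S _; rewrite !ffunE scalerDl scalerA.
Qed.

Lemma contract_chain_linear k v : linear (@contract_chain R n ip k v).
Proof.
apply: dirac_ext_linear => p.
exact: (linear_comp (dirac_linear p) (@contraction_linear k v)).
Qed.

Lemma contraction0 k v : @contraction R n ip k v 0 = 0.
Proof. exact: linear_map0 (@contraction_linear k v). Qed.

Lemma contract_dirac k v p (a : kvector R n k.+1) :
  contract_chain ip v (dirac_chain p a) = dirac_chain p (contraction ip v a).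
Proof.
by rewrite /contract_chain dirac_ext_dirac// => q; rewrite contraction0 dirac0.
Qed.

Lemma contract_chainE k v (A : dchain R n k.+1) q :
  contract_chain ip v A q = contraction ip v (A q).
Proof.
move: A; apply: dchain_linear_ext => [||p a].
- exact: (linear_comp (@dchain_eval_linear _ _ k q) (@contract_chain_linear k v)).
- exact: (linear_comp (@contraction_linear k v) (@dchain_eval_linear _ _ k.+1 q)).
by rewrite contract_dirac/=; case: eqP => // _; rewrite contraction0.
Qed.

Lemma contract_translate k v u (A : dchain R n k.+1) :
  contract_chain ip v (translate u A) = translate u (contract_chain ip v A).
Proof.
by apply/val_inj/funext => q /=; rewrite contract_chainE !translateE contract_chainE.
Qed.

Lemma contract_Delta k v s (A : dchain R n k.+1) :
  contract_chain ip v (Delta s A) = Delta s (contract_chain ip v A).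
Proof.
elim: s => //= u s IH.
by rewrite (linear_sub (@contract_chain_linear k v)) contract_translate IH.
Qed.

End Contraction.

Section Differences.
Context {R : realType} {n : nat}.
Implicit Types k r : nat.

Lemma translate_add k u v (A : dchain R n k) :
  translate (u + v) A = translate u (translate v A).
Proof.
by apply/val_inj/funext => q /=; rewrite !translateE opprD addrA.
Qed.

Lemma translateC k u v (A : dchain R n k) :
  translate u (translate v A) = translate v (translate u A).
Proof. by rewrite -!translate_add addrC. Qed.

Lemma translate0 k (A : dchain R n k) : translate 0 A = A.
Proof. by apply/val_inj/funext => q /=; rewrite translateE subr0. Qed.

Lemma translate_Delta k u s (A : dchain R n k) :
  translate u (Delta s A) = Delta s (translate u A).
Proof.
elim: s => //= v s IH.
by rewrite (linear_sub (translate_linear u)) translateC IH.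
Qed.

Lemma Delta0 k s : Delta s (0 : dchain R n k) = 0.
Proof. by rewrite -[X in Delta s X](scale0r 0) Delta_scale scale0r. Qed.

Lemma Delta_mem0 k s (A : dchain R n k) : 0 \in s -> Delta s A = 0.
Proof.
elim: s => // u s IH; rewrite inE => /predU1P[<-|/IH/= ->].
  by rewrite /= translate0 subrr.
exact: (Delta0 k [:: u]).
Qed.
End Differences.

Definition Bbounded {R : realType} {n : nat} (ip : {dot 'rV[R]_n for idfun})
    (k r : nat) (w : @kform R n k) : Prop :=
  exists2 C, 0 <= C & forall A : dchain R n k, `|w A| <= C * Bnorm ip r A.

Section BnormBounds.
Context {R : realType} {n : nat} (ip : {dot 'rV[R]_n for idfun}).
Implicit Types k r : nat.

Definition Delta_cost k (s : seq 'rV[R]_n) (a : kvector R n k) : R :=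
  (\prod_(u <- s) vnorm ip u) * mass ip a.

Lemma Delta_cost_ge0 k s (a : kvector R n k) : 0 <= Delta_cost s a.
Proof. by rewrite mulr_ge0 ?mass_ge0// prodr_ge0// => u _; exact: vnorm_ge0. Qed.

Lemma Bnorm_Delta_le k r s p (a : kvector R n k) : (size s <= r)%N ->
  Bnorm ip r (Delta s (dirac_chain p a)) <= Delta_cost s a.
Proof.
move=> sr; apply: decomp_norm_le => //.
- exact: diff_cost_ge0.
- exact: diff_chain_gen.
exists [:: (Bseq sr, p, a)].
by rewrite !big_seq1.
Qed.

(** The norm is an infimum over decompositions into generators Delta_s (p; a),
so a seminorm is compared with it on these alone. *)
Lemma Bnorm_bound {W : lmodType R} k r (M : seminorm W) (f : dchain R n k -> W)
    (C : R) A : 0 <= C -> linear f ->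
  (forall s p a, (size s <= r)%N ->
     M (f (Delta s (dirac_chain p a))) <= C * Delta_cost s a) ->
  M (f A) <= C * Bnorm ip r A.
Proof.
move=> C0 f_lin bound; apply: decomp_norm_bound => //; first exact: diff_chain_gen.
by move=> [[s p] a]; apply: bound; exact: size_bseq.
Qed.

Lemma Bnorm_mono k r s (A : dchain R n k) : (r <= s)%N ->
  Bnorm ip s A <= Bnorm ip r A.
Proof.
move=> rs; rewrite -[leRHS]mul1r.
apply: (@Bnorm_bound _ _ _ (Bseminorm ip k s) id) => // t p a tr.
by rewrite mul1r; apply: Bnorm_Delta_le; exact: leq_trans rs.
Qed.

Lemma Bnorm_translate k r u (A : dchain R n k) :
  Bnorm ip r (translate u A) <= Bnorm ip r A.
Proof.
rewrite -[leRHS]mul1r.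
apply: (@Bnorm_bound _ _ _ (Bseminorm ip k r) (translate u)) => //.
  exact: translate_linear.
move=> t p a tr; rewrite mul1r translate_Delta translate_dirac.
exact: Bnorm_Delta_le.
Qed.

(** A further difference raises the order of a generator by one and multiplies
its cost by the length of u. *)
Lemma Bnorm_diff k r u (A : dchain R n k) :
  Bnorm ip r.+1 (translate u A - A) <= vnorm ip u * Bnorm ip r A.
Proof.
apply: (@Bnorm_bound _ _ _ (Bseminorm ip k r.+1) (fun A => translate u A - A)).
- exact: vnorm_ge0.
- by move=> c x y; rewrite translate_linear scalerBr opprD addrACA.
move=> t p a tr; apply: le_trans (@Bnorm_Delta_le k r.+1 (u :: t) p a tr) _.
by rewrite /Delta_cost big_cons mulrA.
Qed.

Context (e : 'I_n -> 'rV[R]_n).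
Hypothesis e_orthonormal : forall i j, ip (e i) (e j) = (i == j)%:R.

Lemma Bnorm_contract k v : exists2 C, 0 <= C &
  forall r (A : dchain R n k.+1),
    Bnorm ip r (contract_chain ip v A) <= C * Bnorm ip r A.
Proof.
have [C C0 aC] := mass_linear_le e_orthonormal (@contraction_linear _ _ ip k v).
exists C => // r A.
apply: (@Bnorm_bound _ _ _ (Bseminorm ip k r) (contract_chain ip v)) => //.
  exact: contract_chain_linear.
move=> t p a tr; rewrite contract_Delta contract_dirac.
apply: le_trans (Bnorm_Delta_le _ _ tr) _.
rewrite /Delta_cost mulrCA ler_wpM2l// prodr_ge0// => u _; exact: vnorm_ge0.
Qed.

(** The form norm bounds w only on the generators of cost 1; positive costs
follow by scaling, and a generator of cost 0 is the zero chain because mass and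
length are definite. *)
Lemma kform_bound k r (w : kform k) : (kform_norm ip r w < +oo)%E ->
  Bbounded ip r w.
Proof.
move=> w_fin; pose K := maxe 0%E (kform_norm ip r w).
have K_fin : K \is a fin_num.
  by rewrite ge0_fin_numE ?le_max ?lexx// gt_max ltry.
exists (fine K) => [|A]; first by rewrite fine_ge0// le_max lexx.
have w_lin : linear (w : dchain R n k -> R^o) by move=> c x y; rewrite linearP.
apply: (@Bnorm_bound R^o k r abs_seminorm w) => //.
  by rewrite fine_ge0// le_max lexx.
move=> s p a sr /=.
have [cost0|cost_neq0] := eqVneq (Delta_cost s a) 0.
  suff -> : Delta s (dirac_chain p a) = 0 by rewrite linear0 normr0 cost0 mulr0.
  move/eqP: cost0; rewrite mulf_eq0 => /orP[|/eqP/(mass_eq0 e_orthonormal)->].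
    rewrite prodf_seq_eq0 => /hasP[u us /eqP/vnorm_eq0 u0].
    by apply: Delta_mem0; rewrite -u0.
  by rewrite dirac0 Delta0.
have cost_gt0 : 0 < Delta_cost s a by rewrite lt_def cost_neq0 Delta_cost_ge0.
pose c := (Delta_cost s a)^-1.
have c_gt0 : 0 < c by rewrite invr_gt0.
have dirac_c := linear_scale c a (dirac_linear p).
rewrite -ler_pdivrMr// mulrC -/c -[leLHS]ger0_norm; last by rewrite mulr_ge0// ltW.
rewrite normrM normr_id -normrM -linearZ -Delta_scale -dirac_c.
rewrite -lee_fin fineK// le_max; apply/orP; right.
apply: le_trans (le_bigmax _ _ (Ordinal (sr : (size s < r.+1)%N))).
apply: ereal_sup_ubound; exists (in_tuple s), p, (c *: a); split => //.
by rewrite massZ ger0_norm ?ltW// mulrCA mulVf.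
Qed.
End BnormBounds.

(** * Derivatives at 0 of quasi-additive functions *)

Section QuasiAdditive.
Context {R : realType} {W : completeNormedModType R} (D : R -> W) (C K : R).
Hypothesis D_add : forall s t, `|D (s + t) - D s - D t| <= C * (`|s| * `|t|).
Hypothesis D_lip : forall t, `|D t| <= K * `|t|.

Let C_ge0 : 0 <= C.
Proof. by have := D_add 1 1; rewrite normr1 !mulr1; apply: le_trans. Qed.

Let K_ge0 : 0 <= K.
Proof. by have := D_lip 1; rewrite normr1 mulr1; apply: le_trans. Qed.

Let D0 : D 0 = 0.
Proof. by apply/eqP; rewrite -normr_le0 (le_trans (D_lip 0))// normr0 mulr0. Qed.

(** The errors C (i s) s of the successive additions, i < m, sum to at most
C (m s)^2. *)
Lemma quasi_additive_muln m s :
  `|D (m%:R * s) - m%:R *: D s| <= C * (m%:R * s) ^+ 2.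
Proof.
elim: m => [|m IH]; first by rewrite !mul0r scale0r D0 subrr normr0 expr0n mulr0.
have -> : D (m.+1%:R * s) - m.+1%:R *: D s =
    (D (m%:R * s + s) - D (m%:R * s) - D s) + (D (m%:R * s) - m%:R *: D s).
  rewrite -natr1 mulrDl mul1r scalerDl scale1r opprD.
  by rewrite [RHS]addrACA subrK [- D s - _]addrC.
apply: le_trans (ler_normD _ _) _; apply: le_trans (lerD (D_add _ _) IH) _.
rewrite -mulrDr ler_wpM2l// normrM (ger0_norm (ler0n _ m)) -mulrA -expr2.
rewrite real_normK ?num_real// !exprMn -mulrDl ler_wpM2r ?sqr_ge0//.
by rewrite -natr1; have := ler0n R m; nra.
Qed.

(** Write t = m s + rho with 0 <= rho < s: then D t is m D s up to
O(t^2) + O(rho), and rho < s <= t^2. *)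
Lemma quasi_additive_quotient s t : 0 < s -> s <= t ^+ 2 -> 0 < t -> t <= 1 ->
  `|t^-1 *: D t - s^-1 *: D s| <= (2 * C + 2 * K) * t.
Proof.
move=> s0 st t0 t1; have ts0 : 0 <= t / s by rewrite divr_ge0// ltW.
set m := Num.truncn (t / s).
have /andP[mle mlt] := truncn_itv ts0.
pose rho := t - m%:R * s.
have ms_t : m%:R * s <= t by rewrite -ler_pdivlMr.
have rho0 : 0 <= rho by rewrite subr_ge0.
have rho_s : rho <= s.
  by rewrite lerBlDr -{1}[s]mul1r -mulrDl nat1r -ler_pdivrMr// ltW.
have tE : t = m%:R * s + rho by rewrite addrC subrK.
have ms0 : 0 <= m%:R * s by rewrite mulr_ge0// ltW.
have main : `|D t - (t / s) *: D s| <= t * ((2 * C + 2 * K) * t).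
  have -> : D t - (t / s) *: D s =
      (D (m%:R * s + rho) - D (m%:R * s) - D rho) + (D (m%:R * s) - m%:R *: D s)
      + D rho - (rho / s) *: D s.
    have -> : t / s = m%:R + rho / s.
      by rewrite {1}tE mulrDl mulfK// gt_eqF.
    rewrite -tE scalerDl opprD.
    rewrite !addrA; congr (_ - _).
    by rewrite [RHS]addrAC; congr (_ - _); rewrite [RHS]addrAC !subrK.
  have h1 := D_add (m%:R * s) rho; have h2 := quasi_additive_muln m s.
  have h3 := D_lip rho.
  have h4 : `|(rho / s) *: D s| <= K * rho.
    rewrite normrZ normrM normfV (ger0_norm rho0) (gtr0_norm s0).
    have := D_lip s; rewrite (gtr0_norm s0) => Ds.
    rewrite mulrAC ler_pdivrMr// (mulrC rho) [K * rho * s]mulrAC.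
    by rewrite ler_wpM2r.
  rewrite (ger0_norm ms0) (ger0_norm rho0) in h1; rewrite (ger0_norm rho0) in h3.
  apply: le_trans (ler_normB _ _) _; apply: le_trans (lerD _ h4) _.
    apply: le_trans (ler_normD _ _) _; apply: le_trans (lerD _ h3) _.
      by apply: le_trans (ler_normD _ _) _; exact: lerD h1 h2.
    exact: lexx.
  have : C * (m%:R * s * rho) <= C * t ^+ 2.
    rewrite ler_wpM2l// (le_trans (ler_pM _ _ ms_t rho_s))//.
    rewrite (le_trans (ler_wpM2l (ltW t0) st))//.
    by rewrite -[leRHS]mul1r ler_wpM2r ?sqr_ge0.
  have : C * (m%:R * s) ^+ 2 <= C * t ^+ 2.
    by rewrite ler_wpM2l// lerXn2r ?nnegrE// ltW.
  have : K * rho <= K * t ^+ 2 by rewrite ler_wpM2l// (le_trans rho_s).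
  by nra.
have -> : t^-1 *: D t - s^-1 *: D s = t^-1 *: (D t - (t / s) *: D s).
  by rewrite scalerBr scalerA mulrA mulVf ?mul1r// gt_eqF.
by rewrite normrZ normfV gtr0_norm// ler_pdivrMl.
Qed.

(** The quotients at del and at |t| <= del are both compared with the one at
t^2, which is small enough for both; the quotients at t and -t differ by O(t)
since D t + D (-t) = - (D (t - t) - D t - D (-t)). *)
Lemma quasi_additive_cvg : cvg (t^-1 *: D t @[t --> (0 : R)^']).
Proof.
apply: cauchy_cvg; apply/cauchyP => eps eps0.
pose A := 2 * C + 2 * K.
have A0 : 0 <= A by rewrite addr_ge0// mulr_ge0.
pose del := Num.min 1 (eps / (2 * A + C + 1)).
have B0 : 0 < 2 * A + C + 1 by rewrite ltr_wpDl// addr_ge0// mulr_ge0.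
(* 2 A bounds the two comparisons and C the change of sign; the 1 keeps the
   denominator positive. *)
have del0 : 0 < del by rewrite lt_min ltr01 divr_gt0.
have del1 : del <= 1 by rewrite ge_min lexx.
have del_eps : (2 * A + C) * del < eps.
  have : del <= eps / (2 * A + C + 1) by rewrite ge_min lexx orbT.
  by rewrite ler_pdivlMr//; nra.
exists (del^-1 *: D del).
suff : \forall t \near (0 : R)^', ball (del^-1 *: D del) eps (t^-1 *: D t) by [].
near=> t; rewrite -ball_normE /ball_/=.
have t_neq0 : t != 0 by near: t; exact: nbhs_dnbhs_neq.
have t_del : `|t| < del by near: t; exact: dnbhs0_lt.
have t0 : 0 < `|t| by rewrite normr_gt0.
have t2 : 0 < `|t| ^+ 2 by rewrite exprn_gt0.
have t2_del : `|t| ^+ 2 <= del ^+ 2 by rewrite lerXn2r ?nnegrE// ltW.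
have h1 := quasi_additive_quotient t2 t2_del del0 del1.
have h2 := quasi_additive_quotient t2 (lexx _) t0 (le_trans (ltW t_del) del1).
have h3 : `|t^-1 *: D t - `|t|^-1 *: D `|t| | <= C * `|t|.
  have [t_ge0|t_lt0] := leP 0 t.
    by rewrite ger0_norm// subrr normr0 mulr_ge0.
  have := D_add t (- t); rewrite subrr D0 sub0r -opprD !normrN => h.
  rewrite ltr0_norm// invrN scaleNr opprK -scalerDr normrZ normfV ltr0_norm//.
  rewrite ler_pdivrMl ?oppr_gt0//; move: h; rewrite ltr0_norm//.
  by congr (_ <= _); ring.
apply: le_lt_trans del_eps.
apply: le_trans (ler_distD (`|t|^-1 *: D `|t|) _ _) _.
apply: le_trans (lerD (ler_distD ((`|t| ^+ 2)^-1 *: D (`|t| ^+ 2)) _ _) (lexx _)) _.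
rewrite [X in _ + X + _]distrC [X in _ + _ + X]distrC.
apply: le_trans (lerD (lerD h1 h2) h3) _.
have : A * `|t| <= A * del by rewrite ler_wpM2l// ltW.
have : C * `|t| <= C * del by rewrite ler_wpM2l// ltW.
by rewrite -/A; lra.
Unshelve. all: by end_near.
Qed.
End QuasiAdditive.

(** * The prederivative operators P_v *)

Section DiffQuotient.
Context {R : realType} {n : nat} (ip : {dot 'rV[R]_n for idfun}).
Implicit Types k r : nat.

Definition chain_quotient k (v : 'rV[R]_n) (A : dchain R n k) (t : R) :
  dchain R n k := t^-1 *: (translate (t *: v) A - A).

Lemma chain_quotient_linear k v t :
  linear (fun A : dchain R n k => chain_quotient v A t).
Proof.
move=> c A B; rewrite /chain_quotient (translate_linear (t *: v)) scalerA mulrC -scalerA.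
by rewrite -scalerDr; congr (_ *: _); rewrite scalerBr opprD addrACA.
Qed.

Lemma chain_quotient_dirac k v p (a : kvector R n k) t :
  chain_quotient v (dirac_chain p a) t = diff_quotient v p a t.
Proof.
rewrite /chain_quotient translate_dirac /diff_quotient.
by rewrite !(linear_scale _ _ (dirac_linear _)) scalerBr.
Qed.

Lemma Bnorm_quotient k r v (A : dchain R n k) t :
  Bnorm ip r.+1 (chain_quotient v A t) <= vnorm ip v * Bnorm ip r A.
Proof.
rewrite BnormZ normfV; have [->|t0] := eqVneq t 0.
  rewrite normr0 invr0 mul0r mulr_ge0 ?vnorm_ge0//.
  exact: (seminorm_ge0 (Bseminorm ip k r)).
rewrite ler_pdivrMl ?normr_gt0// mulrA -vnormZ; exact: Bnorm_diff.
Qed.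

Lemma Bincl_linear k r : linear (Bincl ip r : dchain R n k -> _).
Proof. by move=> c A B; rewrite /Bincl linearP. Qed.

Lemma norm_Bincl k r (A : dchain R n k) : `|Bincl ip r A| = Bnorm ip r A.
Proof. exact: norm_cincl. Qed.

(** D t is the first difference in direction t v; the defect of additivity is
the second difference in the directions s v and t v, whose norm is at most
|s v| |t v| as soon as second differences are allowed in the norm. *)
Lemma prederiv_exists_high k r : prederiv_exists ip k r.+2.
Proof.
move=> v p a.
pose D t := Bincl ip r.+2 (translate (t *: v) (dirac_chain p a) - dirac_chain p a).
pose C := vnorm ip v ^+ 2 * Bnorm ip r (dirac_chain p a).
pose K := vnorm ip v * Bnorm ip r.+1 (dirac_chain p a).
have -> : (fun t => Bincl ip r.+2 (diff_quotient v p a t)) = (fun t => t^-1 *: D t).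
  apply/funext => t; rewrite -chain_quotient_dirac /D.
  by rewrite /chain_quotient /Bincl linearZ.
apply: (@quasi_additive_cvg _ _ D C K) => [s t|t].
- rewrite /D -!linearB.
  set X := dirac_chain p a.
  have -> : translate ((s + t) *: v) X - X - (translate (s *: v) X - X) -
      (translate (t *: v) X - X) =
      translate (s *: v) (translate (t *: v) X - X) - (translate (t *: v) X - X).
    rewrite scalerDl translate_add (linear_sub (translate_linear _)); congr (_ - _).
    by rewrite opprB addrA subrK.
  rewrite [leLHS]norm_Bincl (le_trans (Bnorm_diff _ _ _ _))//.
  rewrite vnormZ (le_trans (ler_wpM2l _ (Bnorm_diff _ _ _ _)))//.
    by rewrite mulr_ge0// vnorm_ge0.
  by rewrite vnormZ /C le_eqVlt; apply/orP; left; apply/eqP; ring.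
rewrite /D [leLHS]norm_Bincl (le_trans (Bnorm_diff _ _ _ _))//.
by rewrite vnormZ /K le_eqVlt; apply/orP; left; apply/eqP; ring.
Qed.

End DiffQuotient.

Section Prederivative.
Context {R : realType} {n : nat} (ip : {dot 'rV[R]_n for idfun}) (k r : nat).
Hypothesis exP : prederiv_exists ip k r.+1.

Definition prederiv v (A : dchain R n k) : Bhat ip k r.+1 :=
  dirac_ext (prederiv_dirac ip r.+1 v) A.

Lemma prederiv_dirac_linear v p : linear (@prederiv_dirac R n ip k r.+1 v p).
Proof.
move=> c a b; apply/cvg_lim; first exact: norm_hausdorff.
have -> : (fun t => Bincl ip r.+1 (diff_quotient v p (c *: a + b) t)) =
   (fun t => c *: Bincl ip r.+1 (diff_quotient v p a t) +
     Bincl ip r.+1 (diff_quotient v p b t)).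
  apply/funext => t; rewrite -!chain_quotient_dirac dirac_linear.
  by rewrite (@chain_quotient_linear _ _ k v t) Bincl_linear.
by apply: cvgD; [apply: cvgZ; [exact: cvg_cst|]|]; exact: exP.
Qed.

Lemma prederiv_linear v : linear (prederiv v).
Proof. by apply: dirac_ext_linear => p; exact: prederiv_dirac_linear. Qed.

Lemma prederiv_dirac_chain v p a :
  prederiv v (dirac_chain p a) = prederiv_dirac ip r.+1 v p a.
Proof.
rewrite /prederiv dirac_ext_dirac// => q.
exact: linear_map0 (@prederiv_dirac_linear v q).
Qed.

(** A chain is a finite sum of point chains, on each of which the limit is the
definition. *)
Lemma prederiv_cvg v A :
  Bincl ip r.+1 (chain_quotient v A t) @[t --> (0 : R)^'] --> prederiv v A.
Proof.
have fA : finite_set [set p | A p != 0] by have /asboolP := dchainP A.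
have AE : A = \sum_(p <- fset_set [set p | A p != 0]) 1 *: dirac_chain p (A p).
  rewrite {1}(dchainE A) (@dirac_extE _ _ _ _ _ A _ (@dirac0 _ _ k) fA)//.
  by apply: eq_bigr => p _; rewrite scale1r.
(* The factors 1 give the sums the form expected by linear_sum_scale. *)
rewrite {1 2}AE (linear_sum_scale _ _ _ (prederiv_linear v)).
have -> : (fun t => Bincl ip r.+1 (chain_quotient v
     (\sum_(p <- fset_set [set p | A p != 0]) 1 *: dirac_chain p (A p)) t)) =
   (fun t => \sum_(p <- fset_set [set p | A p != 0])
     1 *: Bincl ip r.+1 (diff_quotient v p (A p) t)).
  apply/funext => t; rewrite (linear_sum_scale _ _ _ (chain_quotient_linear v t)).
  rewrite (linear_sum_scale _ _ _ (@Bincl_linear _ _ ip k r.+1)).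
  by apply: eq_bigr => p _; rewrite chain_quotient_dirac.
apply: cvg_big; first exact: add_continuous.
move=> p _; apply: cvgZ; first exact: cvg_cst.
by rewrite prederiv_dirac_chain; exact: exP.
Qed.

Lemma prederiv_le v A : `|prederiv v A| <= vnorm ip v * Bnorm ip r A.
Proof.
have /cvg_norm limA := @prederiv_cvg v A.
apply: ler_cvg_to limA (cvg_cst _) _; apply: nearW => t.
by rewrite norm_Bincl; exact: Bnorm_quotient.
Qed.

(** Translations are contractions, so X t may be replaced by a Dirac chain B
near L, on which the difference T_{tu} B - B has norm O(t). *)
Lemma translate_vanish u (X : R -> dchain R n k) (L : Bhat ip k r.+1) :
  Bincl ip r.+1 (X t) @[t --> (0 : R)^'] --> L ->
  Bincl ip r.+1 (translate (t *: u) (X t) - X t) @[t --> (0 : R)^']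
    --> (0 : Bhat ip k r.+1).
Proof.
move=> XL; apply/cvgrPdist_lt => eps eps0.
(* X t - B is within eps / 4 of 0 and occurs twice; the other half of eps is for
   T_{tu} B - B. *)
have e8 : 0 < eps / 8 by rewrite divr_gt0.
have /cvgrPdist_lt/(_ _ e8)[m _ mL] := @crep_cvg _ _ _ L.
pose B := crep L m; have BL : `|L - Bincl ip r.+1 B| < eps / 8 by apply: mL => /=.
pose K := vnorm ip u * Bnorm ip r B.
have K0 : 0 <= K.
  by rewrite mulr_ge0 ?vnorm_ge0//; exact: (seminorm_ge0 (Bseminorm ip k r)).
have K1 : 0 < K + 1 by rewrite ltr_wpDl.
have d0 : 0 < eps / 2 / (K + 1) by rewrite !divr_gt0.
near=> t.
rewrite sub0r normrN norm_Bincl.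
have XB : Bnorm ip r.+1 (X t - B) < eps / 4.
  rewrite -norm_Bincl /Bincl linearB/= -(subrKA L) (le_lt_trans (ler_normD _ _))//.
  rewrite (_ : eps / 4 = eps / 8 + eps / 8); last by field.
  rewrite ltrD// distrC; near: t.
  by move/cvgrPdist_lt/(_ _ e8): XL.
have t_small : `|t| < eps / 2 / (K + 1) by near: t; exact: dnbhs0_lt.
have -> : translate (t *: u) (X t) - X t = translate (t *: u) (X t - B) -
    (X t - B) + (translate (t *: u) B - B).
  rewrite (linear_sub (translate_linear _)) opprB addrACA subrK.
  by rewrite [B - X t - B]addrAC subrr add0r.
apply: le_lt_trans (seminormD (Bseminorm ip k r.+1) _ _) _ => /=.
have h1 : Bnorm ip r.+1 (translate (t *: u) (X t - B) - (X t - B)) <= eps / 4 + eps / 4.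
  apply: le_trans (seminormD (Bseminorm ip k r.+1) _ _) _.
  rewrite seminormN/= lerD ?ltW//.
  exact: le_lt_trans (Bnorm_translate _ _ _ _) XB.
have h2 : Bnorm ip r.+1 (translate (t *: u) B - B) < eps / 2.
  apply: le_lt_trans (Bnorm_diff _ _ _ _) _; rewrite vnormZ -mulrA -/K.
  move: t_small; rewrite ltr_pdivlMr//; apply: le_lt_trans.
  by rewrite ler_wpM2l// lerDl.
by rewrite (_ : eps = eps / 4 + eps / 4 + eps / 2) ?ler_ltD//; field.
Unshelve. all: by end_near.
Qed.

(** With X t the quotient in direction v, the quotient in direction u + v is the
one in direction u plus T_{tu} (X t), and T_{tu} (X t) - X t tends to 0. *)
Lemma prederivD u v A : prederiv (u + v) A = prederiv u A + prederiv v A.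
Proof.
apply: (@cvg_unique _ (@norm_hausdorff _ (Bhat ip k r.+1)) _ _ _ _
  (@prederiv_cvg (u + v) A)).
pose X := chain_quotient v A.
have -> : (fun t => Bincl ip r.+1 (chain_quotient (u + v) A t)) =
   (fun t => Bincl ip r.+1 (chain_quotient u A t) +
     (Bincl ip r.+1 (translate (t *: u) (X t) - X t) + Bincl ip r.+1 (X t))).
  apply/funext => t; rewrite /Bincl -!linearD/=; congr cincl.
  rewrite subrK /X /chain_quotient.
  have -> : translate (t *: u) (t^-1 *: (translate (t *: v) A - A)) =
     t^-1 *: translate (t *: u) (translate (t *: v) A - A).
    exact: linear_scale (translate_linear _).
  rewrite -[RHS]scalerDr (linear_sub (translate_linear _)) [t *: (u + v)]scalerDr.
  rewrite translate_add.
  by rewrite [X in _ = _ *: X]addrC subrKA.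
apply: cvgD; first exact: prederiv_cvg.
rewrite -[X in _ --> X]add0r; apply: cvgD; last exact: prederiv_cvg.
by apply: translate_vanish; exact: prederiv_cvg.
Qed.

Lemma prederivZ c v A : prederiv (c *: v) A = c *: prederiv v A.
Proof.
have [->|c0] := eqVneq c 0.
  apply/eqP; rewrite !scale0r -normr_le0 (le_trans (prederiv_le 0 A))//.
  by rewrite -(scale0r 0) vnormZ normr0 !mul0r.
have ct : c * t @[t --> (0 : R)^'] --> (0 : R)^'.
  have c_cvg : c * t @[t --> (0 : R)] --> (0 : R).
    by rewrite -[X in _ --> X](mulr0 c); apply: cvgM; [exact: cvg_cst|exact: cvg_id].
  move=> S S0; have cS := c_cvg (fun x => x != 0 -> S x) S0.
  apply: (@filterS _ (nbhs (0 : R)) _ _ _ _ cS) => t St t0; apply: St.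
  by rewrite mulf_neq0.
apply: (@cvg_unique _ (@norm_hausdorff _ (Bhat ip k r.+1)) _ _ _ _
  (@prederiv_cvg (c *: v) A)).
have -> : (fun t => Bincl ip r.+1 (chain_quotient (c *: v) A t)) =
   (fun t => c *: Bincl ip r.+1 (chain_quotient v A (c * t))).
  apply/funext => t; rewrite /Bincl -linearZ/= /chain_quotient; congr cincl.
  rewrite [RHS]scalerA invfM mulrA.
  by rewrite mulfV// mul1r [t *: (c *: v)]scalerA (mulrC t).
apply: cvgZ; first exact: cvg_cst.
exact: (cvg_comp _ _ ct (@prederiv_cvg v A)).
Qed.

Lemma prederiv_sum (I : Type) (s : seq I) (c : I -> R) (x : I -> 'rV[R]_n) A :
  prederiv (\sum_(i <- s) c i *: x i) A = \sum_(i <- s) c i *: prederiv (x i) A.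
Proof.
elim: s => [|i s IH]; last by rewrite !big_cons prederivD prederivZ IH.
by rewrite !big_nil -[X in prederiv X](scale0r 0) prederivZ scale0r.
Qed.

End Prederivative.

(** * Integrals of forms and Stokes' theorem on the completions *)

Section Integral.
Context {R : realType} {n : nat} (ip : {dot 'rV[R]_n for idfun}) (k r : nat).
Variables (w : @kform R n k) (C : R).
Hypothesis w_le : forall A : dchain R n k, `|w A| <= C * Bnorm ip r A.

Let w_lin : linear (w : dchain R n k -> R^o).
Proof. by move=> c x y; rewrite linearP. Qed.

Lemma integral_chain_linear :
  linear ((fun J => integral_chain J w) : Bhat ip k r -> R^o).
Proof. exact: (@cext_linear _ _ (Bseminorm ip k r) R^o w C w_lin w_le). Qed.

Lemma integral_chain_cvg {T : Type} (F : set_system T) {FF : Filter F}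
    (u : T -> Bhat ip k r) J :
  u x @[x --> F] --> J -> integral_chain (u x) w @[x --> F] --> integral_chain J w.
Proof.
apply: (@bounded_cvg _ (Bhat ip k r) R^o (fun J => integral_chain J w) C).
  exact: integral_chain_linear.
exact: (@cext_le _ _ (Bseminorm ip k r) R^o w C w_lin w_le).
Qed.

Lemma integral_chain_limit {T : Type} (F : set_system T) {FF : Filter F}
    (u : T -> dchain R n k) (J : Bhat ip k r) :
  Bincl ip r (u x) @[x --> F] --> J -> w (u x) @[x --> F] --> integral_chain J w.
Proof.
exact: (@cvg_cext _ _ (Bseminorm ip k r) R^o w C w_lin w_le).
Qed.
End Integral.

Section Stokes.
Context {R : realType} {n k : nat} (ip : {dot 'rV[R]_n for idfun}).
Context (e : 'I_n -> 'rV[R]_n).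
Hypothesis e_orthonormal : forall i j, ip (e i) (e j) = (i == j)%:R.
Variable w : @kform R n k.

Lemma integral_prederiv r v A : prederiv_exists ip k r.+1 -> Bbounded ip r.+1 w ->
  w (chain_quotient v A t) @[t --> (0 : R)^'] --> integral_chain (prederiv ip r v A) w.
Proof.
move=> exP [C _ w_le]; apply: (integral_chain_limit w_le); exact: prederiv_cvg.
Qed.

Lemma derive_integral r v p a : prederiv_exists ip k r.+1 -> Bbounded ip r.+1 w ->
  'D_v (fun q => w (dirac_chain q a) : R^o) p =
  integral_chain (prederiv ip r v (dirac_chain p a)) w.
Proof.
move=> exP w_bd; have := @integral_prederiv r v (dirac_chain p a) exP w_bd.
move=> wlim; apply/cvg_lim => //.
rewrite (_ : (fun h => _) = (fun t => w (chain_quotient v (dirac_chain p a) t)))//.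
apply/funext => t /=.
by rewrite /chain_quotient translate_dirac [p + _]addrC [RHS]linearZ/= [in RHS]linearB.
Qed.

(** On a basis k-vector both sides are combinations of derivatives of the
coefficients of w: the standard direction row j is expanded in the frame e, and
the coefficients <row j, e_i> are those produced by the contraction with
e_i. *)
Lemma ext_derivE r A : prederiv_exists ip k r.+1 -> Bbounded ip r.+1 w ->
  ext_deriv w A = \sum_(i < n)
    integral_chain (prederiv ip r (e i) (contract_chain ip (e i) A)) w.
Proof.
move=> exP w_bd; case: (w_bd) => C C0 w_le.
pose I i (B : dchain R n k) : R^o := integral_chain (prederiv ip r (e i) B) w.
have I_lin i : linear (I i).
  exact: (linear_comp (integral_chain_linear w_le) (prederiv_linear exP (e i))).
move: A; apply: (@dchain_linear_ext _ _ _ R^o (ext_deriv w)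
    (fun A => \sum_(i < n) I i (contract_chain ip (e i) A))) => [||p a].
- by move=> c A B; rewrite linearP.
- move=> c A B; rewrite scaler_sumr -big_split/=; apply: eq_bigr => i _.
  by rewrite contract_chain_linear I_lin.
have -> : ext_deriv w (dirac_chain p a) = ext_deriv_at w p a.
  rewrite /ext_deriv/= /ext_deriv_fun dirac_ext_dirac// => q.
  by rewrite /ext_deriv_at big1// => S _; rewrite ffunE mul0r.
have J_lin i : linear (I i \o dirac_chain p) by exact: linear_comp (dirac_linear p).
under eq_bigr => i _.
  rewrite contract_dirac -[I i _]/((I i \o dirac_chain p) _).
  rewrite /contraction (linear_sum_scale _ _ _ (J_lin i)).
  under eq_bigr => S _ do rewrite (linear_sum_scale _ _ _ (J_lin i)) /=.
  over.
rewrite exchange_big/=; apply: eq_bigr => S _.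
rewrite -scaler_sumr [RHS]/(_ * _); congr (_ * _).
rewrite exchange_big/=; apply: eq_bigr => j _.
rewrite (derive_integral _ _ _ exP w_bd).
rewrite [in LHS](vec_coords e_orthonormal (row j (std_rows S))) (prederiv_sum exP).
rewrite (linear_sum_scale _ _ _ (integral_chain_linear w_le)).
rewrite mulr_sumr; apply: eq_bigr => i _.
by rewrite [X in _ * X]/(_ * _) mulrA dotC.
Qed.

(** The level s serves only to have derivatives; their size is controlled by
the difference quotients, on which w is bounded at level r + 1.  Keeping s
apart from r covers r = 0, the level of some germs in the inductive limit, where
s = r would ask P to exist in B^1. *)
Lemma ext_deriv_bounded r s : prederiv_exists ip k s.+1 -> Bbounded ip s.+1 w ->
  Bbounded ip r.+1 w -> Bbounded ip r (ext_deriv w).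
Proof.
move=> exP ws [C C0 w_le].
have /choice[K KP] : forall i, exists c, 0 <= c /\ forall A : dchain R n k.+1,
    Bnorm ip r (contract_chain ip (e i) A) <= c * Bnorm ip r A.
  move=> i; have [c c0 cP] := Bnorm_contract e_orthonormal k (e i).
  by exists c.
exists (\sum_(i < n) C * (vnorm ip (e i) * K i)) => [|A].
  by rewrite sumr_ge0// => i _; rewrite !mulr_ge0 ?vnorm_ge0//; case: (KP i).
rewrite (ext_derivE A exP ws) (le_trans (ler_norm_sum _ _ _))// mulr_suml.
rewrite ler_sum// => i _.
have /cvg_norm wlim := @integral_prederiv _ (e i) (contract_chain ip (e i) A) exP ws.
apply: ler_cvg_to wlim (cvg_cst _) _; apply: nearW => t.
rewrite (le_trans (w_le _))// -!mulrA ler_wpM2l//.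
rewrite (le_trans (Bnorm_quotient _ _ _ _ _))// ler_wpM2l ?vnorm_ge0//.
by case: (KP i) => _; apply.
Qed.

(** The boundary is a composition of two extensions by continuity, each of which
may be computed along any chains tending to its argument. *)
Lemma boundary_cvg r (J : Bhat ip k.+1 r) : prederiv_exists ip k r.+1 ->
  \sum_(i < n) prederiv ip r (e i) (contract_chain ip (e i) (crep J j)) @[j --> \oo]
    --> boundary e J.
Proof.
move=> exP; apply: cvg_big; first exact: add_continuous.
move=> i _; have [c c0 cP] := Bnorm_contract e_orthonormal k (e i).
apply: (@cvg_cext _ _ (Bseminorm ip k r) (Bhat ip k r.+1) _ (vnorm ip (e i))).
- exact: prederiv_linear.
- by move=> A; exact: prederiv_le.
apply: (@cvg_cext _ _ (Bseminorm ip k.+1 r) (Bhat ip k r)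
  (fun A => Bincl ip r (contract_chain ip (e i) A)) c).
- exact: (linear_comp (@Bincl_linear _ _ ip k r)
    (@contract_chain_linear _ _ ip k (e i))).
- by move=> A; rewrite norm_Bincl; exact: cP.
exact: crep_cvg.
Qed.

(** The values of dw on Dirac chains tending to J have both integrals as limit:
one by the boundedness of dw, the other by ext_derivE and the convergence of
the boundaries. *)
Lemma stokes_hat r (J : Bhat ip k.+1 r) : prederiv_exists ip k r.+1 ->
  Bbounded ip r.+1 w ->
  integral_chain (boundary e J) w = integral_chain J (ext_deriv w).
Proof.
move=> exP w_bd; case: (w_bd) => C C0 w_le.
have [D D0 dw_le] := @ext_deriv_bounded r r exP w_bd w_bd.
apply: (@cvg_unique _ (@norm_hausdorff _ R^o) (ext_deriv w \o crep J @ \oo)).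
  have -> : ext_deriv w \o crep J = (fun j => integral_chain
      (\sum_(i < n) prederiv ip r (e i) (contract_chain ip (e i) (crep J j))) w).
    apply/funext => j /=; rewrite (ext_derivE _ exP w_bd); apply/esym.
    under eq_bigr do rewrite -[prederiv _ _ _ _]scale1r.
    rewrite (linear_sum_scale _ _ _ (integral_chain_linear w_le)).
    by apply: eq_bigr => i _; rewrite scale1r.
  exact: (integral_chain_cvg w_le (@boundary_cvg r J exP)).
apply: (integral_chain_limit dw_le); exact: crep_cvg.
Qed.
End Stokes.

(** * The inductive limit *)

Section Linking.
Context {R : realType} {n k : nat} (ip : {dot 'rV[R]_n for idfun}).

Lemma integral_link r s (J : Bhat ip k r) (w : @kform R n k) : (r <= s)%N ->
  Bbounded ip r w -> Bbounded ip s w ->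
  integral_chain (Blink s J) w = integral_chain J w.
Proof.
move=> rs [C _ wr] [D _ ws].
apply: (@cvg_unique _ (@norm_hausdorff _ R^o) (w \o crep J @ \oo)).
  apply: (integral_chain_limit ws).
  apply: (@cvg_cext _ _ (Bseminorm ip k r) (Bhat ip k s) _ 1).
  - exact: Bincl_linear.
  - by move=> A; rewrite norm_Bincl mul1r; exact: Bnorm_mono.
  exact: crep_cvg.
apply: (integral_chain_limit wr); exact: crep_cvg.
Qed.

(** The equivalence is generated by linking steps, and integral_link says that
each of them preserves the integral. *)
Lemma integral_germ (x y : germ ip k) (w : @kform R n k) :
  (forall r, Bbounded ip r w) -> germ_equiv x y ->
  integral_chain (tagged x) w = integral_chain (tagged y) w.
Proof.
move=> w_bd /asboolP; elim=> {x y} [_ _ [r s J rs]|//|x y _ ->//|x y z _ -> _ ->//].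
exact/esym/integral_link.
Qed.

Lemma integral_ind_pi (x : germ ip k) (w : @kform R n k) :
  (forall r, Bbounded ip r w) ->
  integral_ind (\pi_(Bind ip k) x) w = integral_chain (tagged x) w.
Proof.
move=> w_bd; apply: integral_germ => //.
have := reprK (\pi_(Bind ip k) x) => /eqP; rewrite eqmodE.
exact.
Qed.
End Linking.

Theorem theorem3p5p4 (R : realType) (n k : nat)
    (ip : {dot 'rV[R]_n for idfun})
    (e : 'I_n -> 'rV[R]_n)
    (he : forall i j : 'I_n, ip (e i) (e j) = (i == j)%:R)
    (hk : (k < n)%N) :
  (forall (r : nat) (hr : (1 <= r)%N)
      (hP : r = 1%N -> prederiv_exists ip k r)
      (J : Bhat ip k.+1 r.-1) (w : kform k) (hw : B_kform ip r w),
      integral_chain (boundary e J) w = integral_chain J (ext_deriv w))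
  /\
  (forall (J : Bind ip k.+1) (w : kform k)
      (hw : forall r : nat, B_kform ip r w),
      integral_ind (boundary_ind e J) w = integral_ind J (ext_deriv w)).
Proof.
split=> [[//|r] _ hP J w [_ w_fin]|J w hw].
  apply: (stokes_hat he); last exact: (kform_bound he).
  by case: r hP {J w_fin} => [|r _]; [apply|exact: prederiv_exists_high].
have w_bd r : Bbounded ip r w by case: (hw r) => _; exact: (kform_bound he).
have dw_bd r : Bbounded ip r (ext_deriv w).
  by apply: (ext_deriv_bounded he (s := 1)) => //; exact: prederiv_exists_high.
rewrite /boundary_ind integral_ind_pi//= (stokes_hat he) ?integral_link//.
exact: prederiv_exists_high.
Qed.
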